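(* Let $\Phi$ and $\Psi$ be jointly stationary and ergodic point processes on $\mathbb{R}^d$ with intensities $1$ and $\alpha\ge1$, respectively. Assume that $(\Phi,\Psi)$ almost surely does not contain an infinite descending chain. Let $\Phi^\tau:=\{p\in\Phi:\tau(\Phi,\Psi,p)\ne\infty\}$ and $\Psi^\tau:=\{x\in\Psi:\tau(\Phi,\Psi,x)\ne\infty\}$. Then $\mathbb{P}(\Phi^\tau=\Phi)=1$. If $\alpha=1$, then also $\mathbb{P}(\Psi^\tau=\Psi)=1$.
   Context: $\mathbf{N}$ is the space of locally finite subsets $\varphi$ of $\mathbb{R}^d$, with the $\sigma$-field generated by the maps $\varphi\mapsto\varphi(B):=\mathrm{card}(\varphi\cap B)$, $B$ Borel. A point process is a random element of $\mathbf{N}$. Joint stationarity means that $(\Phi+x,\Psi+x)$ has the same distribution as $(\Phi,\Psi)$ for all $x\in\mathbb{R}^d$; joint ergodicity means that moreover $\mathbb{P}((\Phi,\Psi)\in A)\in\{0,1\}$ for each measurable $A\subset\mathbf{N}\times\mathbf{N}$ invariant under all simultaneous translations. The intensity of $\Phi$ is $\mathbb{E}\Phi([0,1]^d)$. Matching. Let $\varphi,\psi\in\mathbf{N}$. A point $p\in\varphi$ prefers $x\in\psi$ to $y\in\psi$ if $\|x-p\|<\|y-p\|$, or if $\|x-p\|=\|y-p\|$ and $x$ is lexicographically strictly smaller than $y$. A point $x\in\psi$ prefers $p\in\varphi$ to $q\in\varphi$ if $\|p-x\|<\|q-x\|$, or if $\|p-x\|=\|q-x\|$ and $p$ is lexicographically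 strictly greater than $q$. The mutual nearest neighbour matching $\tau(\varphi,\psi,\cdot)$ is defined as follows: put $\varphi_0:=\varphi$, $\psi_0:=\psi$. Given $\varphi_n,\psi_n$, for each pair $(p,x)\in\varphi_n\times\psi_n$ such that $p$ prefers $x$ to all other points of $\psi_n$ and $x$ prefers $p$ to all other points of $\varphi_n$, set $\tau(\varphi,\psi,p):=x$ and $\tau(\varphi,\psi,x):=p$; let $\varphi_{n+1}\subset\varphi_n$, $\psi_{n+1}\subset\psi_n$ be the points not matched in this step. Points of $\varphi_\infty:=\bigcap_n\varphi_n$ and $\psi_\infty:=\bigcap_n\psi_n$ are never matched and get $\tau(\varphi,\psi,x):=\infty$. For $x\notin\varphi\cup\psi$ put $\tau(\varphi,\psi,x):=x$. An infinite descending chain in $(\varphi,\psi)$ is an infinite sequence $(z_1,z_2,\dots)$ with $z_i\in\varphi$ for odd $i$, $z_i\in\psi$ for even $i$, such that $z_i$ prefers $z_{i+1}$ to $z_{i-1}$ for all $i\ge2$. *)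

(* Defs.v *)
From HB Require Import structures.
From mathcomp Require Import all_boot all_order all_algebra.
From mathcomp Require Import all_classical all_reals all_analysis.
From mathcomp Require Import measurable_realfun.

Set Implicit Arguments.
Unset Strict Implicit.
Unset Printing Implicit Defensive.

Import Order.TTheory GRing.Theory Num.Theory.
Import numFieldNormedType.Exports.

Local Open Scope classical_set_scope.
Local Open Scope ring_scope.

Section euclidean.
Context {R : realType} {d : nat}.
Implicit Types x y : 'rV[R]_d.

(* The norm [`| x |] that the library puts on matrices is the max norm. *)
Definition enorm x : R := Num.sqrt (\sum_(i < d) x 0 i ^+ 2).

Definition lex_lt x y : Prop :=
  exists i : 'I_d, (forall j : 'I_d, (j < i)%N -> x 0 j = y 0 j) /\
    x 0 i < y 0 i.

Definition unit_cube : set 'rV[R]_d := [set x | forall i, 0 <= x 0 i <= 1].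

Definition borel : set (set 'rV[R]_d) := <<s [set U | open U] >>.

Definition locally_finite (phi : set 'rV[R]_d) : Prop :=
  forall B : set 'rV[R]_d, bounded_set B -> finite_set (phi `&` B).

End euclidean.

Record configuration (R : realType) (d : nat) := Configuration {
  points :> set 'rV[R]_d;
  points_locally_finite : locally_finite points
}.

Section configuration_measurable.
Context {R : realType} {d : nat}.

HB.instance Definition _ := gen_eqMixin (configuration R d).
HB.instance Definition _ := gen_choiceMixin (configuration R d).

Lemma locally_finite0 : locally_finite (@set0 'rV[R]_d).
Proof. by move=> B _; rewrite set0I. Qed.

HB.instance Definition _ :=
  isPointed.Build (configuration R d) (Configuration locally_finite0).

Definition npoints (B : set 'rV[R]_d) (phi : configuration R d) : \bar R :=
  counting (points phi `&` B).

Definition npoints_preimages : set (set (configuration R d)) :=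
  \bigcup_(B in borel) preimage_set_system setT (npoints B) measurable.

HB.instance Definition _ := Measurable.copy (configuration R d)
  (g_sigma_algebraType npoints_preimages).

End configuration_measurable.

Section translation.
Context {R : realType} {d : nat}.

Lemma locally_finite_translate (phi : configuration R d) (x : 'rV[R]_d) :
  locally_finite [set y + x | y in points phi].
Proof.
move=> B bB.
apply: (@sub_finite_set _ _ ((fun y => y + x) @`
    (points phi `&` [set y | B (y + x)]))).
  by move=> _ [[y phiy <-] By]; exists y.
apply: finite_image; apply: points_locally_finite.
have [M [Mreal bM]] := bB; exists (M + `|x|).
split=> [|K MK y /= By]; first exact: num_real.
rewrite -[y](addrK x) (le_trans (ler_normB _ _))// -lerBrDr.
by apply: bM => //; rewrite ltrBrDr.
Qed.

Definition translate (x : 'rV[R]_d) (phi : configuration R d) :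
  configuration R d := Configuration (locally_finite_translate phi x).

End translation.

Section matching.
Context {R : realType} {d : nat}.
Local Notation E := 'rV[R]_d.
Implicit Types (phi psi : set E) (p q x y z : E).

(* [p], a point of the first configuration, prefers [x] to [y]. *)
Definition prefers1 p x y : Prop :=
  enorm (x - p) < enorm (y - p) \/
  (enorm (x - p) = enorm (y - p) /\ lex_lt x y).

(* [x], a point of the second configuration, prefers [p] to [q]; ties are
   broken in the opposite direction. *)
Definition prefers2 x p q : Prop :=
  enorm (p - x) < enorm (q - x) \/
  (enorm (p - x) = enorm (q - x) /\ lex_lt q p).

Definition mutual_nearest phi psi p x : Prop :=
  [/\ phi p, psi x,
      forall y, psi y -> y <> x -> prefers1 p x y &
      forall q, phi q -> q <> p -> prefers2 x p q].

Fixpoint unmatched phi psi (n : nat) : set E * set E :=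
  if n is m.+1 then
    let: (phim, psim) := unmatched phi psi m in
    (phim `\` [set p | exists x, mutual_nearest phim psim p x],
     psim `\` [set x | exists p, mutual_nearest phim psim p x])
  else (phi, psi).

Definition never_matched1 phi psi : set E :=
  \bigcap_n (unmatched phi psi n).1.

Definition never_matched2 phi psi : set E :=
  \bigcap_n (unmatched phi psi n).2.

Definition matched phi psi p x : Prop :=
  exists n, mutual_nearest (unmatched phi psi n).1 (unmatched phi psi n).2 p x.

(* [None] stands for the value infinity. A point has at most one partner; one
   that lies in both [phi] and [psi] is its own mutual nearest neighbour, so
   the order of the first two cases is immaterial. *)
Definition tau phi psi z : option E :=
  if pselect (exists x, matched phi psi z x) is left h then
    Some (projT1 (cid h))
  else if pselect (exists p, matched phi psi p z) is left h then
    Some (projT1 (cid h))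
  else if pselect ((never_matched1 phi psi `|` never_matched2 phi psi) z)
    then None
  else Some z.

(* The chain is indexed from 1: [z 0] is irrelevant. *)
Definition infinite_descending_chain phi psi (z : nat -> E) : Prop :=
  (forall i, (1 <= i)%N -> if odd i then phi (z i) else psi (z i)) /\
  (forall i, (2 <= i)%N ->
     if odd i then prefers1 (z i) (z i.+1) (z i.-1)
     else prefers2 (z i) (z i.+1) (z i.-1)).

Definition tau_points1 phi psi : set E :=
  [set p | phi p /\ tau phi psi p <> None].

Definition tau_points2 phi psi : set E :=
  [set x | psi x /\ tau phi psi x <> None].

End matching.

Section point_processes.
Context {R : realType} {d : nat} {dT : measure_display}
  {T : measurableType dT}.
Variable P : probability T R.
Implicit Types Phi Psi : {RV P >-> configuration R d}.

Definition intensity Phi : \bar R := (\int[P]_w npoints unit_cube (Phi w))%E.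

Definition jointly_stationary Phi Psi : Prop :=
  forall (x : 'rV[R]_d) (A : set (configuration R d * configuration R d)),
    measurable A ->
    pushforward P (fun w => (translate x (Phi w), translate x (Psi w))) A =
    pushforward P (fun w => (Phi w, Psi w)) A.

Definition translation_invariant
    (A : set (configuration R d * configuration R d)) : Prop :=
  forall x phi psi, A (translate x phi, translate x psi) <-> A (phi, psi).

Definition jointly_ergodic Phi Psi : Prop :=
  jointly_stationary Phi Psi /\
  forall A : set (configuration R d * configuration R d),
    measurable A -> translation_invariant A ->
    P [set w | A (Phi w, Psi w)] = 0%E \/ P [set w | A (Phi w, Psi w)] = 1%E.

End point_processes.

(* Main.v *)
Require Import Defs.
From mathcomp Require Import all_boot all_order all_algebra.
From mathcomp Require Import all_classical all_reals all_analysis.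
From mathcomp Require Import measurable_realfun lra.

Import Order.TTheory GRing.Theory Num.Theory.
Import numFieldNormedType.Exports.

Local Open Scope classical_set_scope.
Local Open Scope ring_scope.

Set Implicit Arguments.
Unset Strict Implicit.
Unset Printing Implicit Defensive.

(** Never matched points cannot survive on both sides: otherwise, walking from
    a surviving point to its favourite survivor of the other kind, again and
    again, either stops at a pair of mutual favourites, which would have been
    matched at a finite stage, or runs through an infinite descending chain.
    So almost surely one of the two surviving sets is empty, and by ergodicity
    each of them is almost surely empty or almost surely nonempty.  By mass
    transport, matched points of [Phi] and of [Psi] have the same intensity
    [s], hence [1 = s + u1] and [alpha = s + u2], where [u1] and [u2] are the
    intensities of the surviving points.  If survivors of [Phi] exist then
    [u2 = 0], and [alpha >= 1] forces [u1 = 0], so there are none.  If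
    [alpha = 1] the roles can be exchanged.

    Measurability rests on an enumeration of a configuration by countably many
    rational boxes: a box that contains exactly one point designates that
    point, measurably, and by local finiteness every point is designated. *)

(** * The matching of two fixed configurations *)

Section finite_sets.

(** By induction on a list of the elements, comparing the new head with the minimum of the tail.
    With [lt] a preference, it finds the favourite among finitely many candidates. *)
Lemma exists_least {T : eqType} (A : set T) (lt : T -> T -> Prop) :
  (forall x y z, lt x y -> lt y z -> lt x z) ->
  (forall x y, x <> y -> lt x y \/ lt y x) ->
  finite_set A -> A !=set0 ->
  exists2 x, A x & forall y, A y -> y <> x -> lt x y.
Proof.
move=> lt_trans lt_total /finite_seqP[s ->].
elim: s => [|a s IHs] [z zs]; first by [].
have [[b bs]|s0] := pselect (exists b, b \in s); last first.
  exists a => /= [|y]; first by rewrite mem_head.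
  by rewrite in_cons => /orP[/eqP//|ys]; case: s0; exists y.
have [x xs xmin] := IHs (ex_intro _ b bs).
have [->|ax] := eqVneq a x.
  exists x => /= [|y]; first by rewrite mem_head.
  by rewrite in_cons => /orP[/eqP//|/xmin].
have [{}ax|{}ax] := lt_total _ _ (elimN eqP ax).
  exists a => /= [|y]; first by rewrite mem_head.
  rewrite in_cons => /orP[/eqP//|ys] ya.
  have [->//|/eqP/(xmin _ ys)] := eqVneq y x.
  exact: lt_trans.
exists x => /= [|y]; first by rewrite in_cons xs orbT.
by rewrite in_cons => /orP[/eqP->//|/xmin].
Qed.

(** Each of the finitely many points of [A] outside the intersection is lost at some stage; by
    monotonicity the maximum of these stages serves all of them. *)
Lemma finite_bigcap_stage {T : eqType} (A : set T) (S : nat -> set T) :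
  (forall m n, (m <= n)%N -> S n `<=` S m) -> finite_set A ->
  exists n, forall y, A y -> S n y -> (\bigcap_n S n) y.
Proof.
move=> Sdecr /finite_seqP[s ->].
elim: s => [|a s [n sn]]; first by exists 0%N.
have [Sa|/existsNP[m nSa]] := pselect (forall m, S m a).
  exists n => y /=; rewrite in_cons => /orP[/eqP-> _ m _|]; first exact: Sa.
  exact: sn.
exists (maxn n m) => y /=; rewrite in_cons => /orP[/eqP->|ys] Sy.
  by have := Sdecr _ _ (leq_maxr n m) _ Sy.
by apply: sn => //; exact: (Sdecr _ _ (leq_maxl n m)).
Qed.

End finite_sets.

(** * Preferences as strict total orders, and favourites in locally finite sets *)

Section preferences.
Context {R : realType} {d : nat}.
Local Notation E := 'rV[R]_d.
Implicit Types (phi psi : set E) (p q x y z : E).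

Lemma enorm_ge0 x : 0 <= enorm x.
Proof. exact: sqrtr_ge0. Qed.

Lemma enormN x : enorm (- x) = enorm x.
Proof.
by rewrite /enorm; congr Num.sqrt; apply: eq_bigr => i _; rewrite mxE sqrrN.
Qed.

Lemma enorm0 : enorm (0 : E) = 0.
Proof.
by rewrite /enorm big1 ?sqrtr0// => i _; rewrite mxE expr0n.
Qed.

Lemma ler_coord_enorm x i : `|x 0 i| <= enorm x.
Proof.
rewrite -sqrtr_sqr ler_wsqrtr// (bigD1 i)//= lerDl.
by apply: sumr_ge0 => j _; exact: sqr_ge0.
Qed.

(** Local finiteness is stated with the max norm, while preferences compare Euclidean distances;
    this inequality makes Euclidean balls bounded sets. *)
Lemma ler_norm_enorm x : `|x| <= enorm x.
Proof.
rewrite /Num.norm/= mx_normrE; apply: bigmax_le; first exact: enorm_ge0.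
by move=> [i j] _ /=; rewrite (ord1 i); exact: ler_coord_enorm.
Qed.

Lemma enorm_gt0 x : x <> 0 -> 0 < enorm x.
Proof.
by move=> /eqP; rewrite -normr_gt0 => /lt_le_trans; apply; exact: ler_norm_enorm.
Qed.

Lemma finite_enorm_ball phi p r :
  locally_finite phi -> finite_set [set y | phi y /\ enorm (y - p) <= r].
Proof.
move=> lf; apply: (lf [set y | enorm (y - p) <= r]).
exists (r + `|p|); split => [|K rK y /= yr]; first exact: num_real.
rewrite -[y](subrK p) (le_trans (ler_normD _ _))// (le_trans _ (ltW rK))//.
by rewrite lerD2r (le_trans _ yr)// ler_norm_enorm.
Qed.

Lemma lex_lt_irr x : ~ lex_lt x x.
Proof. by move=> [i [_]]; rewrite ltxx. Qed.

Lemma lex_lt_trans x y z : lex_lt x y -> lex_lt y z -> lex_lt x z.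
Proof.
move=> [i [xy xyi]] [j [yz yzj]].
have [ij|ji|/val_inj ij] := ltngtP i j.
- exists i; split=> [k ki|]; first by rewrite xy// yz// (ltn_trans ki).
  by rewrite -yz.
- exists j; split=> [k kj|]; first by rewrite xy ?yz// (ltn_trans kj).
  by rewrite xy.
- exists i; split=> [k ki|]; first by rewrite xy ?yz// -ij.
  by rewrite (lt_trans xyi)// ij.
Qed.

Lemma lex_lt_total x y : x <> y -> lex_lt x y \/ lex_lt y x.
Proof.
move=> xy.
have [i0 xyi0] : exists i, x 0 i != y 0 i.
  apply: contrapT => /forallNP xyE; apply: xy; apply/rowP => i.
  by apply/eqP/negPn/negP/xyE.
(* The least index at which the coordinates differ decides the lexicographic comparison. *)
have [i xyi imin] := @arg_minnP _ i0 (fun i => x 0 i != y 0 i) val xyi0.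
have eqxy (j : 'I_d) : (j < i)%N -> x 0 j = y 0 j.
  by move=> ji; apply/eqP/negPn/negP => /imin; rewrite leqNgt ji.
have [lt|lt|eq] := ltgtP (x 0 i) (y 0 i); last by rewrite eq eqxx in xyi.
- by left; exists i.
- by right; exists i; split=> // j /eqxy.
Qed.

Lemma lex_ltN x y : lex_lt (- x) (- y) <-> lex_lt y x.
Proof.
have lexN (u v : E) : lex_lt u v -> lex_lt (- v) (- u).
  by move=> [i [uv lt]]; exists i; split=> [j ji|]; rewrite !mxE ?ltrN2// uv.
by split=> /lexN //; rewrite !opprK.
Qed.

Lemma prefers1_irr p x : ~ prefers1 p x x.
Proof. by case=> [|[_ /lex_lt_irr]//]; rewrite ltxx. Qed.

Lemma prefers1_trans p x y z :
  prefers1 p x y -> prefers1 p y z -> prefers1 p x z.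
Proof.
move=> [xy|[xy lxy]] [yz|[yz lyz]].
- by left; exact: lt_trans yz.
- by left; rewrite -yz.
- by left; rewrite xy.
- by right; split; [rewrite xy|exact: lex_lt_trans lyz].
Qed.

Lemma prefers1_total p x y : x <> y -> prefers1 p x y \/ prefers1 p y x.
Proof.
move=> /lex_lt_total xy; rewrite /prefers1.
by have [lt|lt|eq] := ltgtP (enorm (x - p)) (enorm (y - p)); intuition.
Qed.

(** The reflection through the origin keeps distances and reverses the lexicographic order, hence
    exchanges the two tie-breaking rules. Facts on [prefers2] thus follow from those on
    [prefers1]. *)
Lemma prefers2N x p q : prefers2 x p q <-> prefers1 (- x) (- p) (- q).
Proof. by rewrite /prefers1 -!opprD !enormN lex_ltN. Qed.

Lemma prefers2_irr x p : ~ prefers2 x p p.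
Proof. by rewrite prefers2N; exact: prefers1_irr. Qed.

Lemma prefers2_trans x p q r :
  prefers2 x p q -> prefers2 x q r -> prefers2 x p r.
Proof. by rewrite !prefers2N; exact: prefers1_trans. Qed.

(** Only finitely many points are at most as far from [p] as a given [x0]; the best of them also
    beats all points farther than [x0], by distance alone. *)
Lemma exists_preferred1 psi p : locally_finite psi -> psi !=set0 ->
  exists2 x, psi x & forall y, psi y -> y <> x -> prefers1 p x y.
Proof.
move=> lf [x0 psix0].
have [||||x [psix xx0] xmin] := @exists_least _
    [set y | psi y /\ enorm (y - p) <= enorm (x0 - p)] (prefers1 p).
- by move=> x y z; exact: prefers1_trans.
- by move=> x y; exact: prefers1_total.
- exact: finite_enorm_ball.
- by exists x0; split.
exists x => // y psiy yx.
have [yx0|yx0] := leP (enorm (y - p)) (enorm (x0 - p)); first exact: xmin.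
by left; exact: le_lt_trans yx0.
Qed.

Lemma locally_finiteN phi :
  locally_finite phi -> locally_finite [set - p | p in phi].
Proof.
move=> lf B [M [Mreal BM]].
apply: (@sub_finite_set _ _ (-%R @` (phi `&` [set p | B (- p)]))).
  by move=> _ [[p phip <-] Bp]; exists p.
apply/finite_image/lf; exists M; split=> // K MK p /= /BM.
by rewrite /= normrN; exact.
Qed.

Lemma exists_preferred2 phi x : locally_finite phi -> phi !=set0 ->
  exists2 p, phi p & forall q, phi q -> q <> p -> prefers2 x p q.
Proof.
move=> lf [p0 phip0].
have [||_ [p phip <-] pmin] :=
    @exists_preferred1 [set - p | p in phi] (- x).
- exact: locally_finiteN.
- by exists (- p0), p0.
exists p => // q phiq qp; apply/prefers2N/pmin; first by exists q.
by move=> /oppr_inj.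
Qed.

End preferences.

(** * Stages of the matching and never matched points *)

Section matching.
Context {R : realType} {d : nat}.
Local Notation E := 'rV[R]_d.
Implicit Types (phi psi : set E) (p q x y z : E).

Lemma unmatchedS1 phi psi n : (unmatched phi psi n.+1).1 =
  (unmatched phi psi n).1 `\` [set p | exists x,
    mutual_nearest (unmatched phi psi n).1 (unmatched phi psi n).2 p x].
Proof. by rewrite /=; case: unmatched. Qed.

Lemma unmatchedS2 phi psi n : (unmatched phi psi n.+1).2 =
  (unmatched phi psi n).2 `\` [set x | exists p,
    mutual_nearest (unmatched phi psi n).1 (unmatched phi psi n).2 p x].
Proof. by rewrite /=; case: unmatched. Qed.

Lemma unmatched_decr phi psi m n : (m <= n)%N ->
  (unmatched phi psi n).1 `<=` (unmatched phi psi m).1 /\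
  (unmatched phi psi n).2 `<=` (unmatched phi psi m).2.
Proof.
move=> /subnK <-; elim: (n - m)%N => [|k [IH1 IH2]]; first by split.
rewrite addSn unmatchedS1 unmatchedS2.
by split=> x [xn _]; [exact: IH1|exact: IH2].
Qed.

Lemma unmatched_sub1 phi psi n : (unmatched phi psi n).1 `<=` phi.
Proof. by have [] := unmatched_decr phi psi (leq0n n). Qed.

Lemma unmatched_sub2 phi psi n : (unmatched phi psi n).2 `<=` psi.
Proof. by have [] := unmatched_decr phi psi (leq0n n). Qed.

Lemma mutual_nearest_fun phi psi p x y :
  mutual_nearest phi psi p x -> mutual_nearest phi psi p y -> x = y.
Proof.
move=> [_ psix px _] [_ psiy py _]; apply: contrapT => xy.
apply: (@prefers1_irr _ _ p x); apply: prefers1_trans (py _ psix _) => //.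
by apply: px => //; exact/nesym.
Qed.

Lemma mutual_nearest_inj phi psi p q x :
  mutual_nearest phi psi p x -> mutual_nearest phi psi q x -> p = q.
Proof.
move=> [phip _ _ xp] [phiq _ _ xq]; apply: contrapT => pq.
apply: (@prefers2_irr _ _ x p); apply: prefers2_trans (xq _ phip _) => //.
by apply: xp => //; exact/nesym.
Qed.

(** A point matched at stage [m] is removed at stage [m.+1], and the stages decrease. With its twin
    for the second configuration, this makes [matched] a one-to-one relation across all stages. *)
Lemma mutual_nearest_lt1 phi psi m n p x y : (m < n)%N ->
  mutual_nearest (unmatched phi psi m).1 (unmatched phi psi m).2 p x ->
  ~ mutual_nearest (unmatched phi psi n).1 (unmatched phi psi n).2 p y.
Proof.
move=> mn px [/(unmatched_decr phi psi mn).1].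
by rewrite unmatchedS1 => -[_]; case; exists x.
Qed.

Lemma mutual_nearest_lt2 phi psi m n p q x : (m < n)%N ->
  mutual_nearest (unmatched phi psi m).1 (unmatched phi psi m).2 p x ->
  ~ mutual_nearest (unmatched phi psi n).1 (unmatched phi psi n).2 q x.
Proof.
move=> mn px [_ /(unmatched_decr phi psi mn).2].
by rewrite unmatchedS2 => -[_]; case; exists p.
Qed.

Lemma matched_fun phi psi p x y :
  matched phi psi p x -> matched phi psi p y -> x = y.
Proof.
move=> [m px] [n py]; have [mn|nm|eq] := ltngtP m n.
- by have := mutual_nearest_lt1 mn px py.
- by have := mutual_nearest_lt1 nm py px.
- by rewrite eq in px; exact: mutual_nearest_fun py.
Qed.

Lemma matched_inj phi psi p q x :
  matched phi psi p x -> matched phi psi q x -> p = q.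
Proof.
move=> [m px] [n qx]; have [mn|nm|eq] := ltngtP m n.
- by have := mutual_nearest_lt2 mn px qx.
- by have := mutual_nearest_lt2 nm qx px.
- by rewrite eq in px; exact: mutual_nearest_inj qx.
Qed.

Lemma matched_sub phi psi p x : matched phi psi p x -> phi p /\ psi x.
Proof. by move=> [n [/unmatched_sub1 ? /unmatched_sub2 ?]]. Qed.

Lemma never_matched1_sub phi psi : never_matched1 phi psi `<=` phi.
Proof. by move=> p /(_ 0%N I). Qed.

Lemma never_matched2_sub phi psi : never_matched2 phi psi `<=` psi.
Proof. by move=> p /(_ 0%N I). Qed.

Lemma never_matched1P phi psi p :
  never_matched1 phi psi p <-> phi p /\ forall x, ~ matched phi psi p x.
Proof.
split=> [np|[phip np] n _].
  split=> [|x [n px]]; first exact: never_matched1_sub np.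
  by have := np n.+1 I; rewrite unmatchedS1 => -[_]; case; exists x.
elim: n => [//|n IHn]; rewrite unmatchedS1; split=> // -[x px].
by apply: (np x); exists n.
Qed.

Lemma never_matched2P phi psi x :
  never_matched2 phi psi x <-> psi x /\ forall p, ~ matched phi psi p x.
Proof.
split=> [nx|[psix nx] n _].
  split=> [|p [n px]]; first exact: never_matched2_sub nx.
  by have := nx n.+1 I; rewrite unmatchedS2 => -[_]; case; exists p.
elim: n => [//|n IHn]; rewrite unmatchedS2; split=> // -[p px].
by apply: (nx p); exists n.
Qed.

(** At distance zero, the point is strictly closer to itself than any other point is, already at
    stage 0. This settles every case in which the two configurations overlap. *)
Lemma matched_self phi psi p : phi p -> psi p -> matched phi psi p p.
Proof.
move=> phip psip; exists 0%N; split=> //= [y _ yp|q _ qp].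
- by left; rewrite subrr enorm0 enorm_gt0//; apply/eqP; rewrite subr_eq0; exact/eqP.
- by left; rewrite subrr enorm0 enorm_gt0//; apply/eqP; rewrite subr_eq0; exact/eqP.
Qed.

(** Only overlaps need care: a point might be matched in one role and never matched in the other. By
    [matched_self] a common point is its own partner, which excludes this. *)
Lemma tauE phi psi z : tau phi psi z = None <->
  (never_matched1 phi psi `|` never_matched2 phi psi) z.
Proof.
rewrite /tau; case: pselect => [[x zx]|nz1].
  split=> // -[/never_matched1P[_ /(_ _ zx)]//|/never_matched2P[psiz nz]].
  by have [phiz _] := matched_sub zx; have := nz _ (matched_self phiz psiz).
case: pselect => [[p pz]|nz2]; last by case: pselect.
split=> // -[/never_matched1P[phiz nz]|/never_matched2P[_ /(_ _ pz)]//].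
by have [_ psiz] := matched_sub pz; have := nz _ (matched_self phiz psiz).
Qed.

Lemma tau_points1E phi psi :
  tau_points1 phi psi = phi <-> never_matched1 phi psi = set0.
Proof.
split=> [tphi|nm0]; apply/seteqP; split=> //.
- move=> p np; have := never_matched1_sub np; rewrite -tphi => -[_].
  by apply; apply/tauE; left.
- by move=> p [].
- move=> p phip; split=> // /tauE; rewrite nm0 => -[//|/never_matched2P[psip]].
  by move=> /(_ p); apply; exact: matched_self.
Qed.

Lemma tau_points2E phi psi :
  tau_points2 phi psi = psi <-> never_matched2 phi psi = set0.
Proof.
split=> [tpsi|nm0]; apply/seteqP; split=> //.
- move=> p np; have := never_matched2_sub np; rewrite -tpsi => -[_].
  by apply; apply/tauE; right.
- by move=> p [].
- move=> p psip; split=> // /tauE; rewrite nm0 => -[/never_matched1P[phip]|//].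
  by move=> /(_ p); apply; exact: matched_self.
Qed.

(* A pair that is mutually nearest among the never matched points is already
   mutually nearest at a finite stage: only finitely many points compete. *)
Lemma never_matched_not_mutual_nearest phi psi p x :
  locally_finite phi -> locally_finite psi ->
  ~ mutual_nearest (never_matched1 phi psi) (never_matched2 phi psi) p x.
Proof.
move=> lphi lpsi [np nx px xp].
have [n1 Hn1] := @finite_bigcap_stage _ _ (fun n => (unmatched phi psi n).1)
  (fun m n mn => (unmatched_decr phi psi mn).1)
  (finite_enorm_ball x (enorm (p - x)) lphi).
have [n2 Hn2] := @finite_bigcap_stage _ _ (fun n => (unmatched phi psi n).2)
  (fun m n mn => (unmatched_decr phi psi mn).2)
  (finite_enorm_ball p (enorm (x - p)) lpsi).
pose n := maxn n1 n2.
have /never_matched1P[_ /(_ x)] := np; apply; exists n; split.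
- exact: np.
- exact: nx.
- move=> y psiny yx; have [yp|] := leP (enorm (y - p)) (enorm (x - p)); last by left.
  apply: px => //; apply: Hn2; first by split=> //; exact: unmatched_sub2 psiny.
  exact: (unmatched_decr phi psi (leq_maxr n1 n2)).2 psiny.
- move=> q phinq qp; have [qx|] := leP (enorm (q - x)) (enorm (p - x)); last by left.
  apply: xp => //; apply: Hn1; first by split=> //; exact: unmatched_sub1 phinq.
  exact: (unmatched_decr phi psi (leq_maxl n1 n2)).1 phinq.
Qed.

Lemma no_chain_never_matched phi psi :
  locally_finite phi -> locally_finite psi ->
  (~ exists z : nat -> E, infinite_descending_chain phi psi z) ->
  never_matched1 phi psi = set0 \/ never_matched2 phi psi = set0.
Proof.
move=> lphi lpsi nochain; apply: contrapT => /not_orP[].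
move=> /eqP/set0P[p0 np0] /eqP/set0P[x0 nx0]; apply: nochain.
set nphi := never_matched1 phi psi; set npsi := never_matched2 phi psi.
have lnphi : locally_finite nphi.
  by move=> B /lphi; apply: sub_finite_set; apply: setSI => ? /never_matched1_sub.
have lnpsi : locally_finite npsi.
  by move=> B /lpsi; apply: sub_finite_set; apply: setSI => ? /never_matched2_sub.
have /choice[b1 b1P] : forall p, exists x, npsi x /\
    forall y, npsi y -> y <> x -> prefers1 p x y.
  move=> p; have [||x] := @exists_preferred1 _ _ npsi p; first exact: lnpsi.
    by exists x0.
  by exists x.
have /choice[b2 b2P] : forall x, exists p, nphi p /\
    forall q, nphi q -> q <> p -> prefers2 x p q.
  move=> x; have [||p] := @exists_preferred2 _ _ nphi x; first exact: lnphi.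
    by exists p0.
  by exists p.
(* The walk starts at index 1 in [p0], and odd indices hold points of the first configuration; the
   value at 0 is a filler. *)
have [z z1 zS] : exists2 z : nat -> E, z 1%N = p0 &
    forall i, (1 <= i)%N -> z i.+1 = if odd i then b1 (z i) else b2 (z i).
  exists (fix z i := if i is j.+1 then
    (if j is 0 then p0 else if odd j then b1 (z j) else b2 (z j)) else p0) => //.
  by case.
have zin i : (1 <= i)%N -> if odd i then nphi (z i) else npsi (z i).
  case: i => [//|[_|i _]]; first by rewrite z1.
  rewrite zS//= negbK.
  by case: (odd i) => /=; [exact: (b2P _).1|exact: (b1P _).1].
exists z; split=> [i /zin|].
  by case: ifP => _; [exact: never_matched1_sub|exact: never_matched2_sub].
case=> [//|[//|i _]]; have zi1 := zin i.+1 isT; have zi2 := zin i.+2 isT.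
have := zin i.+3 isT; have zS2 := zS i.+1 isT; have zS3 := zS i.+2 isT.
have -> : i.+2.-1 = i.+1 by [].
rewrite /= negbK in zi1 zi2 zS2 zS3 *.
case: (odd i) zi1 zi2 zS2 zS3 => /= zi1 zi2 zS2 zS3 zi3.
  (* The favourite [z i.+3] of [z i.+2] is preferred to [z i.+1] unless the two coincide. In that
     case [z i.+2] and [z i.+1] are favourites of each other among the survivors, which is
     impossible. *)
  rewrite zS3; apply: (b1P _).2 => // zE.
  apply: (@never_matched_not_mutual_nearest phi psi (z i.+2) (z i.+1)) => //.
  split=> //; first by rewrite zE; exact: (b1P _).2.
  by rewrite zS2; exact: (b2P _).2.
rewrite zS3; apply: (b2P _).2 => // zE.
apply: (@never_matched_not_mutual_nearest phi psi (z i.+1) (z i.+2)) => //.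
split=> //; first by rewrite zS2; exact: (b1P _).2.
by rewrite zE; exact: (b2P _).2.
Qed.

End matching.

(** * Translation covariance of the matching *)

Section covariance.
Context {R : realType} {d : nat}.
Local Notation E := 'rV[R]_d.
Implicit Types (phi psi A : set E) (p q x y v : E).

(** On the points of a configuration this is convertible to the points of [translate v], so the
    covariance lemmas for bare sets apply to configurations as they stand. *)
Definition shift_set v A : set E := [set y + v | y in A].

Lemma shiftE v A x : shift_set v A (x + v) <-> A x.
Proof. by split=> [[y Ay /addIr <-//]|Ax]; exists x. Qed.

Lemma prefers1_shift v p x y :
  prefers1 (p + v) (x + v) (y + v) <-> prefers1 p x y.
Proof.
have lexD (z u w : E) : lex_lt u w -> lex_lt (u + z) (w + z).
  by move=> [i [uw lt]]; exists i; split=> [j ji|]; rewrite !mxE ?ltrD2r// uw.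
have lexE : lex_lt (x + v) (y + v) <-> lex_lt x y.
  by split=> [/(lexD (- v))|/lexD//]; rewrite !addrK.
by rewrite /prefers1 !opprD !(addrACA _ v) subrr !addr0 lexE.
Qed.

Lemma prefers2_shift v x p q :
  prefers2 (x + v) (p + v) (q + v) <-> prefers2 x p q.
Proof. by rewrite !prefers2N !opprD prefers1_shift. Qed.

Lemma mutual_nearest_shift v phi psi p x :
  mutual_nearest (shift_set v phi) (shift_set v psi) (p + v) (x + v) <->
  mutual_nearest phi psi p x.
Proof.
rewrite /mutual_nearest; split=> -[phip psix px xp].
  split.
  - exact/(shiftE v).
  - exact/(shiftE v).
  - move=> y psiy yx; apply/(prefers1_shift v); apply: px; first exact/shiftE.
    by move=> /addIr.
  - move=> q phiq qp; apply/(prefers2_shift v); apply: xp; first exact/shiftE.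
    by move=> /addIr.
split.
- exact/shiftE.
- exact/shiftE.
- move=> _ [y psiy <-] yx; apply/prefers1_shift; apply: px => // yxE.
  by apply: yx; rewrite yxE.
- move=> _ [q phiq <-] qp; apply/prefers2_shift; apply: xp => // qpE.
  by apply: qp; rewrite qpE.
Qed.

Lemma unmatched_shift v phi psi n : unmatched (shift_set v phi) (shift_set v psi) n =
  (shift_set v (unmatched phi psi n).1, shift_set v (unmatched phi psi n).2).
Proof.
elim: n => [//|n IHn]; rewrite unmatchedS1 unmatchedS2 /= IHn /=.
congr pair; apply/seteqP; split.
- move=> _ [[p phip <-] np]; apply/shiftE; split=> // -[x px].
  by apply: np; exists (x + v); exact/mutual_nearest_shift.
- move=> _ [p [phip np] <-]; split; first exact/shiftE.
  move=> [x px]; apply: np; exists (x - v).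
  by apply/(mutual_nearest_shift v); rewrite subrK.
- move=> _ [[x psix <-] nx]; apply/shiftE; split=> // -[p px].
  by apply: nx; exists (p + v); exact/mutual_nearest_shift.
- move=> _ [x [psix nx] <-]; split; first exact/shiftE.
  move=> [p px]; apply: nx; exists (p - v).
  by apply/(mutual_nearest_shift v); rewrite subrK.
Qed.

Lemma matched_shift v phi psi p x :
  matched (shift_set v phi) (shift_set v psi) (p + v) (x + v) <-> matched phi psi p x.
Proof.
by split=> -[n px]; exists n; move: px;
  rewrite unmatched_shift mutual_nearest_shift.
Qed.

Lemma never_matched1_shift v phi psi :
  never_matched1 (shift_set v phi) (shift_set v psi) = shift_set v (never_matched1 phi psi).
Proof.
apply/seteqP; split=> [x nx|_ [p np <-] n _]; last first.
  by rewrite unmatched_shift; apply/shiftE/np.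
rewrite -(subrK v x); apply/shiftE => n _; apply/(shiftE v).
by rewrite subrK; have := nx n I; rewrite unmatched_shift.
Qed.

Lemma never_matched2_shift v phi psi :
  never_matched2 (shift_set v phi) (shift_set v psi) = shift_set v (never_matched2 phi psi).
Proof.
apply/seteqP; split=> [x nx|_ [p np <-] n _]; last first.
  by rewrite unmatched_shift; apply/shiftE/np.
rewrite -(subrK v x); apply/shiftE => n _; apply/(shiftE v).
by rewrite subrK; have := nx n I; rewrite unmatched_shift.
Qed.

End covariance.

(** * Counting and measurability *)

Section counting_lemmas.
Context {T : pointedType} {R : realType}.
Implicit Types A B : set T.
Local Notation counting := (@counting T R).
Local Open Scope ereal_scope.

(** The type is given the sigma-algebra generated by all its subsets: every set is then measurable,
    and countable additivity holds without side conditions. *)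
Lemma counting_bigcup (F : nat -> set T) : trivIset setT F ->
  counting (\bigcup_n F n) = \sum_(n <oo) counting (F n).
Proof.
move=> tF.
have mT (A : set (g_sigma_algebraType (@setT (set T)))) : measurable A.
  exact: sub_sigma_algebra.
exact: (@measure_semi_bigcup _ R (g_sigma_algebraType (@setT (set T)))
  counting).
Qed.

Lemma counting_ge0 A : 0 <= counting A.
Proof. by rewrite /counting; case: ifPn; rewrite ?lee_fin// lee_pinfty. Qed.

Lemma counting0 : counting set0 = 0.
Proof. by rewrite /counting asboolT// fset_set0. Qed.

Lemma countingU A B : A `&` B = set0 ->
  counting (A `|` B) = counting A + counting B.
Proof.
move=> AB; rewrite -bigcup2E counting_bigcup.
  rewrite (@nneseries_split _ _ 0 2)//=; last by move=> k _; exact: counting_ge0.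
  rewrite eseries0 ?adde0; last by move=> [|[|k]]//= _ _; exact: counting0.
  by rewrite big_mkord 2!big_ord_recl big_ord0 adde0.
move=> i j _ _.
by case: i j => [|[|i]] [|[|j]]//=; rewrite ?setI0 ?set0I ?AB//; case=> // x [];
  move: AB => /seteqP[AB _] Bx Ax; case: (AB x).
Qed.

Lemma le_counting A B : A `<=` B -> counting A <= counting B.
Proof.
move=> AB; rewrite -(setDUK AB) countingU ?leeDl ?counting_ge0//.
by rewrite setDE setICA setICr setI0.
Qed.

Lemma card_eq_counting {S : pointedType} A (B : set S) : (A #= B)%card ->
  counting A = @counting_measure.counting S R B.
Proof.
move=> AB.
have eqfin : finite_set A <-> finite_set B.
  by rewrite (eq_finite_set AB).
rewrite /counting_measure.counting; case: ifPn => /asboolP finA; last first.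
  by rewrite asboolF// -eqfin.
rewrite asboolT -?eqfin//; congr ((_%:R)%:E); apply/esym.
have /finite_setP[n Bn] : finite_set B by apply/eqfin.
by rewrite (card_fset_set Bn) (card_fset_set (card_eq_trans AB Bn)).
Qed.

Lemma counting1P A : counting A = 1 <-> exists x, A = [set x].
Proof.
rewrite /counting_measure.counting; split=> [|[x ->]]; last first.
  by rewrite asboolT// fset_set1 finmap.cardfs1.
case: ifPn => // /asboolP finA [] /eqP; rewrite pnatr_eq1.
move=> /finmap.cardfs1P[x Ax]; exists x.
by rewrite -[A]fset_setK// Ax; apply/seteqP; split=> y /=;
  rewrite finmap.inE => /eqP.
Qed.

Lemma counting_eq0 A : counting A = 0 -> A = set0.
Proof.
move=> A0; apply/eqP/negPn/negP => /set0P[x Ax].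
have : counting [set x] <= 0 by rewrite -A0; apply: le_counting => _ ->.
by rewrite (counting1P _).2 ?lee_fin ?ler10//; exists x.
Qed.

(** An indicator written as a count: it turns the count of a disjoint union of optional points into
    a series of indicators. *)
Lemma counting_if (P : Prop) x :
  counting [set y | P /\ y = x] = (if `[< P >] then 1 else 0).
Proof.
case: asboolP => p; first by apply/counting1P; exists x;
  apply/seteqP; split=> [y []//|y ->].
by rewrite (_ : mkset _ = set0) ?counting0// -subset0 => y [].
Qed.

End counting_lemmas.

(** * Measurable predicates under countable logical operations *)

Section measurable_predicates.
Context {dd : measure_display} {W : measurableType dd}.
Implicit Types P Q : W -> Prop.

Lemma measurable_Pand P Q : measurable [set w | P w] -> measurable [set w | Q w] ->
  measurable [set w | P w /\ Q w].
Proof. exact: measurableI. Qed.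

Lemma measurable_Por P Q : measurable [set w | P w] -> measurable [set w | Q w] ->
  measurable [set w | P w \/ Q w].
Proof. exact: measurableU. Qed.

Lemma measurable_Pnot P : measurable [set w | P w] -> measurable [set w | ~ P w].
Proof. exact: measurableC. Qed.

Lemma measurable_cst_prop (p : Prop) : measurable [set w : W | p].
Proof.
have [hp|hp] := pselect p.
  rewrite (_ : mkset _ = setT); first exact: measurableT.
  by apply/seteqP; split.
rewrite (_ : mkset _ = set0); first exact: measurable0.
by apply/seteqP; split.
Qed.

Lemma measurable_imply P Q : measurable [set w | P w] ->
  measurable [set w | Q w] -> measurable [set w | P w -> Q w].
Proof.
move=> mP mQ; rewrite (_ : mkset _ = [set w | ~ P w \/ Q w]).
  exact/measurable_Por/mQ/measurable_Pnot.
by apply/seteqP; split=> w /=; have [] := pselect (P w); tauto.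
Qed.

Lemma measurable_exists {I : countType} (P : I -> W -> Prop) :
  (forall i, measurable [set w | P i w]) -> measurable [set w | exists i, P i w].
Proof.
move=> mP; rewrite (_ : mkset _ = \bigcup_i [set w | P i w]).
  by apply: countable_bigcupT_measurable => //; exact: countableP.
by apply/seteqP; split=> [w [i]|w [i _]]; exists i.
Qed.

Lemma measurable_forall {I : countType} (P : I -> W -> Prop) :
  (forall i, measurable [set w | P i w]) -> measurable [set w | forall i, P i w].
Proof.
move=> mP; rewrite (_ : mkset _ = [set w | ~ exists i, ~ P i w]).
  by apply: measurable_Pnot; apply: measurable_exists => i; exact: measurable_Pnot.
by apply/seteqP; split=> w /=; [move=> Pw [i]; exact|move/forallNP => + i;
  move=> /(_ i)/contrapT].
Qed.

End measurable_predicates.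

(** * Random points: measurable comparisons and counts *)

Section random_points.
Context {R : realType} {d : nat} {dd : measure_display} {W : measurableType dd}.
Local Notation E := 'rV[R]_d.

(** Measurability is asked coordinate by coordinate, the form in which Euclidean distances and
    lexicographic comparisons use it. *)
Definition measurable_point (f : W -> E) : Prop :=
  forall k, measurable_fun [set: W] (fun w => f w 0 k).

Lemma measurable_bool (f : W -> bool) : measurable_fun setT f ->
  measurable [set w | f w].
Proof. by move=> mf; rewrite -[X in measurable X]setTI; apply: (mf _ [set true]). Qed.

Lemma measurable_ltr (f g : W -> R) : measurable_fun setT f ->
  measurable_fun setT g -> measurable [set w | f w < g w].
Proof. by move=> mf mg; exact/measurable_bool/measurable_fun_ltr. Qed.

Lemma measurable_ler (f g : W -> R) : measurable_fun setT f ->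
  measurable_fun setT g -> measurable [set w | f w <= g w].
Proof. by move=> mf mg; exact/measurable_bool/measurable_fun_ler. Qed.

Lemma measurable_eqr (f g : W -> R) : measurable_fun setT f ->
  measurable_fun setT g -> measurable [set w | f w = g w].
Proof.
move=> mf mg; have := measurable_bool (measurable_fun_eqr mf mg).
by congr measurable; apply/seteqP; split=> w /= /eqP.
Qed.

Lemma measurable_enormB (f g : W -> E) : measurable_point f ->
  measurable_point g -> measurable_fun setT (fun w => enorm (f w - g w)).
Proof.
move=> mf mg; rewrite /enorm.
apply: (measurableT_comp (continuous_measurable_fun (@sqrt_continuous R))).
apply: measurable_sum => i; apply: measurable_funX.
under eq_fun do rewrite !mxE.
exact: measurable_funB.
Qed.

Lemma measurable_eq_point (f g : W -> E) : measurable_point f ->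
  measurable_point g -> measurable [set w | f w = g w].
Proof.
move=> mf mg; rewrite (_ : mkset _ = [set w | forall k, f w 0 k = g w 0 k]).
  by apply: measurable_forall => k; exact: measurable_eqr.
by apply/seteqP; split=> w /= => [->//|fg]; apply/rowP.
Qed.

Lemma measurable_lex_lt (f g : W -> E) : measurable_point f ->
  measurable_point g -> measurable [set w | lex_lt (f w) (g w)].
Proof.
move=> mf mg; apply: measurable_exists => i; apply: measurable_Pand.
  apply: measurable_forall => j; apply: measurable_imply.
    exact: measurable_cst_prop.
  exact: measurable_eqr.
exact: measurable_ltr.
Qed.

Lemma measurable_prefers1 (f g h : W -> E) : measurable_point f ->
  measurable_point g -> measurable_point h ->
  measurable [set w | prefers1 (f w) (g w) (h w)].
Proof.
move=> mf mg mh; apply: measurable_Por.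
  by apply: measurable_ltr; exact: measurable_enormB.
apply: measurable_Pand; last exact: measurable_lex_lt.
by apply: measurable_eqr; exact: measurable_enormB.
Qed.

Lemma measurable_prefers2 (f g h : W -> E) : measurable_point f ->
  measurable_point g -> measurable_point h ->
  measurable [set w | prefers2 (f w) (g w) (h w)].
Proof.
move=> mf mg mh; apply: measurable_Por.
  by apply: measurable_ltr; exact: measurable_enormB.
apply: measurable_Pand; last exact: measurable_lex_lt.
by apply: measurable_eqr; exact: measurable_enormB.
Qed.

Lemma measurable_counting_seq (f : nat -> W -> E) (D : nat -> W -> Prop) :
  (forall i, measurable_point (f i)) ->
  (forall i, measurable [set w | D i w]) ->
  measurable_fun setT (fun w => counting [set f i w | i in [set i | D i w]]
    : \bar R).
Proof.
move=> mf mD.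
(* Keeping only the first index at which a point is listed counts it once. *)
pose D' i w := D i w /\ forall j : 'I_i, ~ (D j w /\ f j w = f i w).
have -> : (fun w => counting [set f i w | i in [set i | D i w]] : \bar R) =
    (fun w => \sum_(i <oo) counting [set y | D' i w /\ y = f i w])%E.
  apply/funext => w; rewrite -counting_bigcup; last first.
    move=> i j _ _ [y [[[Di ni] yi] [[Dj nj] yj]]].
    have [ij|ji|//] := ltngtP i j.
      by exfalso; apply: (nj (Ordinal ij)); rewrite -yj.
    by exfalso; apply: (ni (Ordinal ji)); rewrite -yi.
  congr counting; apply/seteqP; split=> [_ [i Di <-]|y [i _ [[Di _] ->]]]; last by exists i.
  have ex : exists j, `[< D j w /\ f j w = f i w >] by exists i; apply/asboolP.
  have [j /asboolP[Dj fj] jmin] := ex_minnP ex; exists j => //; split=> //.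
  split=> // k [Dk fk]; have /jmin : `[< D k w /\ f k w = f i w >].
    by apply/asboolP; rewrite fk.
  by rewrite leqNgt ltn_ord.
apply: ge0_emeasurable_sum => [i w _ _|i _]; first exact: counting_ge0.
under eq_fun do rewrite counting_if.
apply: measurable_fun_ifT => //; apply: (measurable_fun_bool true).
rewrite setTI (_ : _ @^-1` _ = [set w | D' i w]).
  apply: measurable_Pand => //; apply: measurable_forall => j.
  by apply/measurable_Pnot/measurable_Pand => //; exact: measurable_eq_point.
by apply/seteqP; split=> w /= /asboolP.
Qed.

(** The index type is numbered by [pickle]. A number that decodes to no index gets the predicate
    [False], so the value 0 listed there is never counted. *)
Lemma measurable_counting {I : countType} (f : I -> W -> E)
    (D : I -> W -> Prop) :
  (forall i, measurable_point (f i)) ->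
  (forall i, measurable [set w | D i w]) ->
  measurable_fun setT (fun w => counting [set f i w | i in [set i | D i w]]
    : \bar R).
Proof.
move=> mf mD.
have := @measurable_counting_seq
  (fun n w => if unpickle n is Some i then f i w else 0)
  (fun n w => if unpickle n is Some i then D i w else False).
set g := (fun w => _); set h := (fun w => _) => mg.
suff -> : h = g.
  apply: mg => n; case: unpickle => [i|].
  - exact: mf.
  - by move=> k; exact: measurable_cst.
  - exact: mD.
  - exact: measurable_cst_prop.
apply/funext => w; congr counting; apply/seteqP; split=> [_ [i Di <-]|y [n]].
  by exists (pickle i); rewrite /= pickleK.
by rewrite /=; case: unpickle => [i Di <-|[]]; first by exists i.
Qed.

End random_points.

(** * Measurable enumeration of the points of a configuration *)

Section locating.
Context {R : realType} {d : nat}.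
Local Notation E := 'rV[R]_d.
Local Notation conf := (configuration R d).
Local Notation index := ('rV[rat]_d * 'rV[rat]_d)%type.
Implicit Types (phi : conf) (i : index) (p x : E).

Definition box i : set E :=
  [set x | forall k, ratr (i.1 0 k) < x 0 k < ratr (i.2 0 k)].

Lemma borel_coord (k : 'I_d) (A : set R) : open A -> borel [set x : E | A (x 0 k)].
Proof.
move=> oA; apply: sub_sigma_algebra.
by apply: (@open_comp _ _ (fun x : E => x 0 k)) => // x _; exact: coord_continuous.
Qed.

Lemma borel_box i : borel (box i).
Proof.
apply: (@measurable_forall _ (g_sigma_algebraType [set U : set E | open U])).
move=> l; rewrite (_ : mkset _ = [set x : E | ratr (i.1 0 l) < x 0 l] `&`
  [set x | x 0 l < ratr (i.2 0 l)]); last first.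
  by apply/seteqP; split=> x /= => [/andP[]//|[? ?]]; apply/andP.
apply: (@measurableI _ (g_sigma_algebraType [set U : set E | open U])).
  exact: (borel_coord _ (@open_gt _ _)).
exact: (borel_coord _ (@open_lt _ _)).
Qed.

Lemma borel_box_lt i k r : borel (box i `&` [set x | x 0 k < r]).
Proof.
apply: (@measurableI _ (g_sigma_algebraType [set U : set E | open U])).
  exact: borel_box.
exact: (borel_coord _ (@open_lt _ _)).
Qed.

Lemma measurable_npoints (B : set E) : borel B ->
  measurable_fun [set: conf] (npoints B).
Proof.
move=> bB _ Y mY; apply: sub_sigma_algebra; exists B => //.
by exists Y.
Qed.

Lemma measurable_npoints1 (B : set E) : borel B ->
  measurable [set phi : conf | npoints B phi = 1%E].
Proof.
move=> bB; rewrite -[X in measurable X]setTI.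
by apply: (measurable_npoints bB measurableT (Y := [set 1%E])).
Qed.

Definition located i phi : Prop := npoints (box i) phi = 1%E.

(** The value 0 is a default for boxes that do not contain exactly one point; it says nothing about
    the configuration, so uses of [locate] are paired with [located]. *)
Definition locate i phi : E :=
  if `[< located i phi >] then xget 0 (points phi `&` box i) else 0.

Lemma measurable_located i : measurable [set phi | located i phi].
Proof. exact: (measurable_npoints1 (borel_box i)). Qed.

Lemma locateE i phi : located i phi -> points phi `&` box i = [set locate i phi].
Proof.
move=> li; rewrite /locate asboolT//.
have /counting1P[x ->] := li.
by have -> : xget 0 [set x] = x := xgetPex 0 (ex_intro [set x] x erefl).
Qed.

Lemma locate_in i phi : located i phi -> points phi (locate i phi).
Proof.
move=> /locateE e; have : [set locate i phi] (locate i phi) by [].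
by rewrite -e => -[].
Qed.

(** Local finiteness isolates [p] in a small ball of the max norm, and density of the rationals puts
    a rational box around [p] inside that ball. *)
Lemma exists_located phi p : points phi p ->
  exists2 i, located i phi & locate i phi = p.
Proof.
move=> phip; pose B := [set y : E | `|y - p| <= 1].
have bB : bounded_set B.
  exists (1 + `|p|); split=> [|K pK y /= yB]; first exact: num_real.
  rewrite -[y](subrK p) (le_trans (ler_normD _ _))// (le_trans _ (ltW pK))//.
  by rewrite lerD2r.
have /finite_seqP[s sE] := @points_locally_finite _ _ phi _ bB.
(* The radius [e] is at most the distance from [p] to every other point listed in [s], and at most
   1, so that a point within [e] of [p] does occur in [s]. *)
have [e /andP[e0 e1] es] : exists2 e : R, 0 < e <= 1 &
    forall y, y \in s -> y <> p -> e <= `|y - p|.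
  elim: (s) => [|y t [e /andP[e0 e1] et]]; first by exists 1; rewrite ?ltr01 ?lexx.
  have [->|yp] := eqVneq y p.
    exists e; first by rewrite e0.
    by move=> z; rewrite in_cons => /orP[/eqP->//|]; exact: et.
  exists (Num.min e `|y - p|).
    by rewrite lt_min e0 normr_gt0 subr_eq0 yp ge_min e1.
  move=> z; rewrite in_cons => /orP[/eqP-> _|/et zt zp].
    by rewrite ge_min lexx orbT.
  by rewrite ge_min zt.
have /choice[a aP] : forall k, exists q : rat, ratr q \in `]p 0 k - e, p 0 k[.
  by move=> k; apply: rat_in_itvoo; rewrite ltrBlDr ltrDl.
have /choice[b bP] : forall k, exists q : rat, ratr q \in `]p 0 k, p 0 k + e[.
  by move=> k; apply: rat_in_itvoo; rewrite ltrDl.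
pose i : index := (\row_k a k, \row_k b k).
have ip : box i p.
  move=> k; rewrite !mxE; have := aP k; have := bP k; rewrite !in_itv/=.
  by move=> /andP[-> _] /andP[_ ->].
have boxP : points phi `&` box i = [set p].
  apply/seteqP; split=> [y [phiy iy]|_ ->//].
  have ye : `|y - p| < e.
    rewrite /Num.norm/= mx_normrE; apply: bigmax_lt => // -[j k] _ /=.
    rewrite (ord1 j) !mxE; have := iy k; rewrite !mxE.
    have := aP k; have := bP k; rewrite !in_itv/= => /andP[_ be] /andP[ae _].
    move=> /andP[ay yb]; rewrite ltr_distl; apply/andP; split.
      exact: lt_trans ay.
    exact: lt_trans be.
  apply: contrapT => yp; have : y \in s.
    suff : [set` s] y by [].
    by rewrite -sE; split=> //; rewrite /B/= (le_trans (ltW ye)).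
  by move=> /es/(_ yp); rewrite leNgt ye.
have li : located i phi by apply/counting1P; exists p.
exists i => //; have : [set p] (locate i phi); last by [].
by rewrite -boxP (locateE li).
Qed.

(** Open lower half-lines suffice. If the box holds a single point, its coordinate lies below [r]
    exactly when the box cut at height [r] still holds one point, which is an event about counts;
    otherwise the default 0 is compared with [r]. *)
Lemma measurable_locate i : measurable_point (locate i).
Proof.
move=> k; apply: (measurability _ (RGenInftyO.measurableE R)).
move=> _ [_ [r ->] <-]; rewrite setTI.
rewrite (_ : _ @^-1` _ =
  ([set phi | located i phi] `&`
    [set phi | npoints (box i `&` [set x : E | x 0 k < r]) phi = 1%E]) `|`
  (~` [set phi | located i phi] `&` [set phi | 0 < r])).
  apply: measurableU; apply: measurableI.
  - exact: measurable_located.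
  - exact: measurable_npoints1 (borel_box_lt i k r).
  - exact: measurableC (measurable_located i).
  - exact: measurable_cst_prop.
have locr phi : located i phi ->
    npoints (box i `&` [set x : E | x 0 k < r]) phi = 1%E <-> locate i phi 0 k < r.
  move=> li; rewrite /npoints setIA (locateE li) counting1P; split=> [[x]|lr].
    move=> xE; have : [set x] x by [].
    by rewrite -xE => -[->].
  exists (locate i phi); apply/seteqP; split=> [x []//|_ -> /=].
  by split.
apply/seteqP; split=> phi /=; rewrite in_itv/=.
  have [li|li] := pselect (located i phi); first by move=> lr; left; rewrite locr.
  by rewrite /locate asboolF// mxE; right.
case=> -[li]; first by rewrite locr.
by rewrite /locate asboolF// mxE.
Qed.

End locating.

(** * Measurability of the matching *)

Section measurable_matching.
Context {R : realType} {d : nat}.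
Local Notation E := 'rV[R]_d.
Local Notation conf := (configuration R d).
Local Notation index := ('rV[rat]_d * 'rV[rat]_d)%type.
Context {dd : measure_display} {W : measurableType dd}.
Variables X Y : W -> conf.
Hypothesis mX : measurable_fun setT X.
Hypothesis mY : measurable_fun setT Y.
Implicit Types (i j l : index) (n : nat) (w : W).

Let P1 i w : E := locate i (X w).
Let P2 i w : E := locate i (Y w).
Let L1 i w := located i (X w).
Let L2 i w := located i (Y w).

Lemma measurable_locate1 i : measurable_point (P1 i).
Proof.
by move=> k; exact: (measurableT_comp (measurable_locate i k) mX).
Qed.

Lemma measurable_locate2 i : measurable_point (P2 i).
Proof.
by move=> k; exact: (measurableT_comp (measurable_locate i k) mY).
Qed.

Lemma measurable_located1 i : measurable [set w | L1 i w].
Proof.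
by have := mX measurableT (measurable_located i); rewrite setTI.
Qed.

Lemma measurable_located2 i : measurable [set w | L2 i w].
Proof.
by have := mY measurableT (measurable_located i); rewrite setTI.
Qed.

Let U1 n w := (unmatched (X w) (Y w) n).1.
Let U2 n w := (unmatched (X w) (Y w) n).2.

(** Quantification over all competing points becomes quantification over countably many boxes, which
    preserves measurability. *)
Lemma mutual_nearest_locate n i j w :
  L1 i w -> L2 j w ->
  mutual_nearest (U1 n w) (U2 n w) (P1 i w) (P2 j w) <->
  [/\ U1 n w (P1 i w), U2 n w (P2 j w),
      forall l, L2 l w /\ U2 n w (P2 l w) -> P2 l w <> P2 j w ->
        prefers1 (P1 i w) (P2 j w) (P2 l w) &
      forall l, L1 l w /\ U1 n w (P1 l w) -> P1 l w <> P1 i w ->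
        prefers2 (P2 j w) (P1 i w) (P1 l w)].
Proof.
move=> Li Lj; split=> -[ui uj p1 p2]; split=> //.
- by move=> l [_ ul]; exact: p1.
- by move=> l [_ ul]; exact: p2.
- move=> y uy; have [l Ll ly] := exists_located (unmatched_sub2 uy).
  by move: uy; rewrite -ly => uy; apply: p1.
- move=> q uq; have [l Ll lq] := exists_located (unmatched_sub1 uq).
  by move: uq; rewrite -lq => uq; apply: p2.
Qed.

Lemma measurable_mutual_nearest n :
  (forall i, measurable [set w | L1 i w /\ U1 n w (P1 i w)]) ->
  (forall i, measurable [set w | L2 i w /\ U2 n w (P2 i w)]) ->
  forall i j, measurable [set w | [/\ L1 i w, L2 j w &
    mutual_nearest (U1 n w) (U2 n w) (P1 i w) (P2 j w)]].
Proof.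
move=> m1 m2 i j.
rewrite (_ : mkset _ = [set w |
    ((L1 i w /\ U1 n w (P1 i w)) /\ (L2 j w /\ U2 n w (P2 j w))) /\
    ((forall l, L2 l w /\ U2 n w (P2 l w) -> P2 l w <> P2 j w ->
        prefers1 (P1 i w) (P2 j w) (P2 l w)) /\
     (forall l, L1 l w /\ U1 n w (P1 l w) -> P1 l w <> P1 i w ->
        prefers2 (P2 j w) (P1 i w) (P1 l w)))]); last first.
  apply/seteqP; split=> w /=.
    by move=> [Li Lj /(mutual_nearest_locate n Li Lj)[]].
  by move=> [[[Li ui] [Lj uj]] [p1 p2]]; split=> //; exact/mutual_nearest_locate.
have mL1 := measurable_locate1; have mL2 := measurable_locate2.
apply: measurable_Pand; first exact: measurable_Pand.
apply: measurable_Pand; apply: measurable_forall => l.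
- apply: measurable_imply => //; apply: measurable_imply.
    by apply: measurable_Pnot; exact: measurable_eq_point.
  exact: measurable_prefers1.
- apply: measurable_imply => //; apply: measurable_imply.
    by apply: measurable_Pnot; exact: measurable_eq_point.
  exact: measurable_prefers2.
Qed.

(** Both sides are treated in one induction: the survivors of a stage determine its mutual nearest
    pairs, and removing these pairs gives the survivors of the next stage. *)
Lemma measurable_unmatched n :
  (forall i, measurable [set w | L1 i w /\ U1 n w (P1 i w)]) /\
  (forall i, measurable [set w | L2 i w /\ U2 n w (P2 i w)]).
Proof.
elim: n => [|n [IH1 IH2]].
  split=> i.
    rewrite (_ : mkset _ = [set w | L1 i w]); first exact: measurable_located1.
    by apply/seteqP; split=> w /= => [[]//|Li]; split=> //; exact: locate_in.
  rewrite (_ : mkset _ = [set w | L2 i w]); first exact: measurable_located2.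
  by apply/seteqP; split=> w /= => [[]//|Li]; split=> //; exact: locate_in.
have mm := measurable_mutual_nearest IH1 IH2.
split=> i.
  rewrite (_ : mkset _ = [set w | (L1 i w /\ U1 n w (P1 i w)) /\
    ~ exists j, [/\ L1 i w, L2 j w &
      mutual_nearest (U1 n w) (U2 n w) (P1 i w) (P2 j w)]]); last first.
    apply/seteqP; split=> w /=; rewrite /U1 unmatchedS1.
      move=> [Li [ui nm]]; split=> // -[j [_ Lj m]].
      by apply: nm; exists (P2 j w).
    move=> [[Li ui] nm]; split=> //; split=> // -[x m]; apply: nm.
    have [_ ux _ _] := m; have [j Lj jx] := exists_located (unmatched_sub2 ux).
    by exists j; split=> //; rewrite /P2 jx.
  apply: measurable_Pand => //; apply: measurable_Pnot.
  by apply: measurable_exists => j; exact: mm.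
rewrite (_ : mkset _ = [set w | (L2 i w /\ U2 n w (P2 i w)) /\
  ~ exists j, [/\ L1 j w, L2 i w &
    mutual_nearest (U1 n w) (U2 n w) (P1 j w) (P2 i w)]]); last first.
  apply/seteqP; split=> w /=; rewrite /U2 unmatchedS2.
    move=> [Li [ui nm]]; split=> // -[j [Lj _ m]].
    by apply: nm; exists (P1 j w).
  move=> [[Li ui] nm]; split=> //; split=> // -[p m]; apply: nm.
  have [up _ _ _] := m; have [j Lj jp] := exists_located (unmatched_sub1 up).
  by exists j; split=> //; rewrite /P1 jp.
apply: measurable_Pand => //; apply: measurable_Pnot.
by apply: measurable_exists => j; exact: mm.
Qed.

Lemma measurable_matched i j : measurable [set w |
  [/\ L1 i w, L2 j w & matched (X w) (Y w) (P1 i w) (P2 j w)]].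
Proof.
rewrite (_ : mkset _ = [set w | exists n, [/\ L1 i w, L2 j w &
    mutual_nearest (U1 n w) (U2 n w) (P1 i w) (P2 j w)]]).
  apply: measurable_exists => n; have [m1 m2] := measurable_unmatched n.
  exact: measurable_mutual_nearest.
by apply/seteqP; split=> w /= => [[Li Lj [n m]]|[n [Li Lj m]]];
  [exists n|split=> //; exists n].
Qed.

(** The test sets for locating points: membership of a random point in [A] must be an event. Cells,
    tiles and the closed unit cube all qualify. *)
Definition coord_measurable (A : set E) : Prop :=
  forall f : W -> E, measurable_point f -> measurable [set w | A (f w)].

Definition matched_into (B : set E) w : set E :=
  [set p | exists2 x, B x & matched (X w) (Y w) p x].

Definition matched_from (A : set E) w : set E :=
  [set x | exists2 p, A p & matched (X w) (Y w) p x].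

Lemma measurable_matched_into B i : coord_measurable B ->
  measurable [set w | L1 i w /\ matched_into B w (P1 i w)].
Proof.
move=> mB; rewrite (_ : mkset _ = [set w | exists j, B (P2 j w) /\
    [/\ L1 i w, L2 j w & matched (X w) (Y w) (P1 i w) (P2 j w)]]).
  apply: measurable_exists => j; apply: measurable_Pand.
    exact/mB/measurable_locate2.
  exact: measurable_matched.
apply/seteqP; split=> w /= => [[Li [x Bx m]]|[j [Bj [Li Lj m]]]].
  have [j Lj jx] := exists_located (matched_sub m).2.
  by exists j; rewrite /P2 jx.
by split=> //; exists (P2 j w).
Qed.

Lemma measurable_matched_from A j : coord_measurable A ->
  measurable [set w | L2 j w /\ matched_from A w (P2 j w)].
Proof.
move=> mA; rewrite (_ : mkset _ = [set w | exists i, A (P1 i w) /\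
    [/\ L1 i w, L2 j w & matched (X w) (Y w) (P1 i w) (P2 j w)]]).
  apply: measurable_exists => i; apply: measurable_Pand.
    exact/mA/measurable_locate1.
  exact: measurable_matched.
apply/seteqP; split=> w /= => [[Lj [p Ap m]]|[i [Ai [Li Lj m]]]].
  have [i Li ip] := exists_located (matched_sub m).1.
  by exists i; rewrite /P1 ip.
by split=> //; exists (P1 i w).
Qed.

Lemma coord_measurableT : coord_measurable setT.
Proof. by move=> f mf; exact: measurable_cst_prop. Qed.

Lemma measurable_never_matched1 i :
  measurable [set w | L1 i w /\ never_matched1 (X w) (Y w) (P1 i w)].
Proof.
(* The condition [L1 i w] is repeated under the negation, since being matched is known to be an
   event only jointly with it. *)
rewrite (_ : mkset _ = [set w | L1 i w /\
    ~ (L1 i w /\ matched_into setT w (P1 i w))]).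
  apply: measurable_Pand; first exact: measurable_located1.
  exact/measurable_Pnot/measurable_matched_into/coord_measurableT.
apply/seteqP; split=> w /= [Li nm]; split=> //.
  by move=> [_ [x _]]; have /never_matched1P[_] := nm; exact.
apply/never_matched1P; split; first exact: locate_in.
by move=> x m; apply: nm; split=> //; exists x.
Qed.

Lemma measurable_never_matched2 i :
  measurable [set w | L2 i w /\ never_matched2 (X w) (Y w) (P2 i w)].
Proof.
rewrite (_ : mkset _ = [set w | L2 i w /\
    ~ (L2 i w /\ matched_from setT w (P2 i w))]).
  apply: measurable_Pand; first exact: measurable_located2.
  exact/measurable_Pnot/measurable_matched_from/coord_measurableT.
apply/seteqP; split=> w /= [Li nm]; split=> //.
  by move=> [_ [p _]]; have /never_matched2P[_] := nm; exact.
apply/never_matched2P; split; first exact: locate_in.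
by move=> x m; apply: nm; split=> //; exists x.
Qed.

Lemma measurable_never_matched1_ex :
  measurable [set w : W | never_matched1 (X w) (Y w) !=set0].
Proof.
rewrite (_ : mkset _ = [set w | exists i,
  L1 i w /\ never_matched1 (X w) (Y w) (P1 i w)]).
  by apply: measurable_exists => i; exact: measurable_never_matched1.
apply/seteqP; split=> w /= => [[p np]|[i [_ ni]]]; last by exists (P1 i w).
have [i Li ip] := exists_located (never_matched1_sub np).
by exists i; rewrite /P1 ip.
Qed.

Lemma measurable_never_matched2_ex :
  measurable [set w : W | never_matched2 (X w) (Y w) !=set0].
Proof.
rewrite (_ : mkset _ = [set w | exists i,
  L2 i w /\ never_matched2 (X w) (Y w) (P2 i w)]).
  by apply: measurable_exists => i; exact: measurable_never_matched2.
apply/seteqP; split=> w /= => [[p np]|[i [_ ni]]]; last by exists (P2 i w).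
have [i Li ip] := exists_located (never_matched2_sub np).
by exists i; rewrite /P2 ip.
Qed.

Lemma measurable_counting_points (S : W -> set E) A :
  (forall w, S w `<=` X w) -> coord_measurable A ->
  (forall i, measurable [set w | L1 i w /\ S w (P1 i w)]) ->
  measurable_fun setT (fun w => counting (S w `&` A) : \bar R).
Proof.
move=> Ssub mA mS; rewrite (_ : (fun w => _) = fun w => counting
    [set P1 i w | i in [set i | (L1 i w /\ S w (P1 i w)) /\ A (P1 i w)]]).
  apply: measurable_counting => [i|i]; first exact: measurable_locate1.
  by apply: measurable_Pand => //; exact/mA/measurable_locate1.
apply/funext => w; congr counting; apply/seteqP; split=> [p [Sp Ap]|_ [i [[_ ?] ?] <-]//].
have [i Li ip] := exists_located (Ssub _ _ Sp).
by exists i => //=; rewrite /P1 ip.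
Qed.

End measurable_matching.

(** * Mass transport *)

Section translation.
Context {R : realType} {d : nat}.
Local Notation E := 'rV[R]_d.
Local Notation conf := (configuration R d).
Implicit Types (phi psi : conf) (A B : set E) (v x : E).

Lemma card_shift v A : (shift_set v A #= A)%card.
Proof. by apply: inj_card_eq => x y _ _ /addIr. Qed.

Lemma counting_shift v A : counting (shift_set v A) = counting A :> \bar R.
Proof. exact/card_eq_counting/card_shift. Qed.

Lemma shiftI v A B : shift_set v (A `&` B) = shift_set v A `&` shift_set v B.
Proof.
apply/seteqP; split=> [_ [x [Ax Bx] <-]|_ [[x Ax <-] /shiftE Bx]].
  by split; exact/shiftE.
exact/shiftE.
Qed.

Lemma shiftNK v A : shift_set v (shift_set (- v) A) = A.
Proof.
apply/seteqP; split=> [_ [_ [x Ax <-] <-]|x Ax]; first by rewrite subrK.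
by rewrite -(subrK v x); do 2 apply/shiftE.
Qed.

Lemma borel_shift v A : borel A -> borel (shift_set v A).
Proof.
pose W := g_sigma_algebraType [set U : set E | open U].
have mf : @measurable_fun _ _ W W setT (fun x : E => x - v).
  apply: (measurability _ (erefl (@measurable _ W))).
  move=> _ [B oB <-]; rewrite setTI; apply: sub_sigma_algebra.
  apply: (@open_comp _ _ (fun x : E => x - v)) => // x _.
  exact: (cvgB cvg_id (cvg_cst _)).
move=> bA; have := mf measurableT A bA; rewrite setTI.
congr (borel _); apply/seteqP; split=> [x Ax|_ [x Ax <-]].
  by exists (x - v) => //; rewrite subrK.
by rewrite /= addrK.
Qed.

Lemma npoints_translate v B phi :
  npoints (shift_set v B) (translate v phi) = npoints B phi.
Proof. by rewrite /npoints -shiftI counting_shift. Qed.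

(** The counts generate the sigma-field, and the count in [B] after translation by [v] is the
    original count in [B] moved by [- v]. *)
Lemma measurable_translate v : measurable_fun [set: conf] (translate v).
Proof.
apply: (measurability _ (erefl (@measurable _ conf))).
move=> _ [_ [B bB [Y mY <-]] <-]; rewrite setTI setTI.
rewrite (_ : translate v @^-1` _ = npoints (shift_set (- v) B) @^-1` Y).
  by have := measurable_npoints (borel_shift (- v) bB) measurableT mY;
    rewrite setTI.
rewrite -comp_preimage; congr (_ @^-1` Y); apply/funext => phi /=.
by rewrite -[in LHS](shiftNK v B) npoints_translate.
Qed.

(** Half-open, so that the integer translates partition the space; the closed [unit_cube] of the
    intensity would overlap its neighbours. *)
Definition cell v : set E := [set x | forall k, v 0 k <= x 0 k /\ x 0 k < v 0 k + 1].

Lemma shift_cell v u : shift_set v (cell u) = cell (u + v).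
Proof.
apply/seteqP; split=> [_ [x xu <-] k|x xuv].
  by rewrite !mxE addrAC lerD2r ltrD2r; exact: xu.
exists (x - v); last by rewrite subrK.
move=> k; have := xuv k; rewrite !mxE.
by rewrite lerBrDr ltrBlDr addrAC.
Qed.

(* The lattice translates of the half-open unit cube, listed by [nat]; with
   [s] the identity or the opposite, this is the same tiling in two orders. *)
Definition tile (s : 'rV[int]_d -> 'rV[int]_d) (n : nat) : set E :=
  if pickle_inv n is Some z then cell (map_mx intr (s z)) else set0.

Lemma cell_floor (z : 'rV[int]_d) x :
  cell (map_mx intr z) x <-> z = map_mx Num.floor x.
Proof.
split=> [zx|-> k].
  apply/rowP => k; rewrite mxE; apply/esym/floor_def.
  by have [] := zx k; rewrite mxE intrD => -> ->.
by have /andP[] := floor_itv (x 0 k); rewrite !mxE intrD.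
Qed.

Lemma bigcup_tile s : involutive s -> \bigcup_n tile s n = setT.
Proof.
move=> sK; apply/seteqP; split=> // x _.
exists (pickle (s (map_mx Num.floor x))) => //.
by rewrite /tile pickleK_inv sK; apply/cell_floor.
Qed.

Lemma trivIset_tile s : involutive s -> trivIset setT (tile s).
Proof.
move=> sK m n _ _ [x []]; rewrite /tile.
case zE : (pickle_inv m) => [z|//] /cell_floor xz.
case tE : (pickle_inv n) => [t|//] /cell_floor; rewrite -xz => /(can_inj sK) tz.
(* [pickle_inv] decodes genuine codes only, so two numbers that decode to the same lattice vector
   are equal and no tile is listed twice. *)
have := @pickle_invK 'rV[int]_d m; have := @pickle_invK 'rV[int]_d n.
by rewrite zE tE /= tz => <- <-.
Qed.

Lemma counting_tiles s (S : set E) (F : nat -> set E) : involutive s ->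
  (forall n, F n = S `&` tile s n) ->
  counting S = (\sum_(n <oo) counting (F n))%E :> \bar R.
Proof.
move=> sK FE; rewrite -counting_bigcup.
  by under eq_bigcupr do rewrite FE; rewrite -setI_bigcupr bigcup_tile// setIT.
move=> m n _ _ [x []]; rewrite !FE => -[_ xm] [_ xn].
by apply: (trivIset_tile sK) => //; exists x.
Qed.

Section coord_measurable_sets.
Context {dd : measure_display} {W : measurableType dd}.

Lemma coord_measurable_cell v : @coord_measurable R d dd W (cell v).
Proof.
move=> f mf; apply: measurable_forall => k.
apply: measurable_Pand; first by apply: measurable_ler.
exact: measurable_ltr.
Qed.

Lemma coord_measurable_tile s n : @coord_measurable R d dd W (tile s n).
Proof.
rewrite /tile; case: pickle_inv => [z|]; first exact: coord_measurable_cell.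
by move=> f mf; exact: measurable_cst_prop.
Qed.

Lemma coord_measurable_unit_cube : @coord_measurable R d dd W unit_cube.
Proof.
move=> f mf; apply: measurable_forall => k.
rewrite (_ : mkset _ = [set w | 0 <= f w 0 k /\ f w 0 k <= 1]).
  by apply: measurable_Pand; exact: measurable_ler.
by apply/seteqP; split=> w /= /andP.
Qed.

Lemma measurable_npoints_coord (X : W -> conf) A : measurable_fun setT X ->
  coord_measurable (W := W) A -> measurable_fun setT (fun w => npoints A (X w)).
Proof.
move=> mX mA; apply: (@measurable_counting_points _ _ _ _ _ mX (fun w => points (X w)) A) => // [w|i];
  first exact: subset_refl.
 rewrite (_ : mkset _ = [set w | located i (X w)]).
  exact: measurable_located1.
by apply/seteqP; split=> w /= => [[]//|Li]; split=> //; exact: locate_in.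
Qed.

End coord_measurable_sets.

End translation.

(** * Stationary means, mass transport and intensities *)

Section transport.
Context {R : realType} {d : nat} {dT : measure_display} {T : measurableType dT}.
Local Notation E := 'rV[R]_d.
Local Notation conf := (configuration R d).
Variables (P : probability T R) (Phi Psi : {RV P >-> conf}).
Hypothesis stationary : jointly_stationary Phi Psi.
Implicit Types (A B : set E) (v x : E) (w : conf * conf).
Local Open Scope ereal_scope.

Definition mean (f : conf * conf -> \bar R) : \bar R :=
  \int[P]_t f (Phi t, Psi t).

Lemma measurable_pair : measurable_fun setT (fun t => (Phi t, Psi t)).
Proof. exact: measurable_fun_pair. Qed.

(** Both sides are integrals of [f] against laws of pairs, the translated and the original one,
    which agree by stationarity. *)
Lemma mean_translate v (f : conf * conf -> \bar R) :
  measurable_fun setT f -> (forall w, 0 <= f w) ->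
  mean (fun w => f (translate v w.1, translate v w.2)) = mean f.
Proof.
move=> mf f0; rewrite /mean /=.
have mF : measurable_fun setT (fun t => (translate v (Phi t), translate v (Psi t))).
  by apply: measurable_fun_pair; apply: measurableT_comp => //;
    exact: measurable_translate.
have {}f0 : {in setT, forall w, 0 <= f w} by move=> w _.
have := ge0_integral_pushforward mF P measurableT mf f0.
have := ge0_integral_pushforward measurable_pair P measurableT mf f0.
rewrite !preimage_setT => <- <-.
apply: eq_measure_integral; first exact: measurable_pair.
by move=> ? A mA _; have := stationary v mA.
Qed.

Definition translation_covariant (S : conf * conf -> set E) : Prop :=
  forall v w, S (translate v w.1, translate v w.2) = shift_set v (S w).

Definition measurable_counts (S : conf * conf -> set E) : Prop :=
  forall A, coord_measurable (W := (conf * conf)%type) A ->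
    measurable_fun setT (fun w => counting (S w `&` A) : \bar R).

Lemma measurable_counts_pair S A : measurable_counts S ->
  coord_measurable (W := (conf * conf)%type) A ->
  measurable_fun setT (fun t => counting (S (Phi t, Psi t) `&` A) : \bar R).
Proof. by move=> mS mA; exact: measurableT_comp (mS A mA) measurable_pair. Qed.

Lemma mean_ge0 (f : conf * conf -> \bar R) : (forall w, 0 <= f w) -> 0 <= mean f.
Proof. by move=> f0; apply: integral_ge0. Qed.

Lemma mean_counting_shift S v A : translation_covariant S ->
  measurable_counts S -> coord_measurable (W := (conf * conf)%type) (shift_set v A) ->
  mean (fun w => counting (S w `&` shift_set v A)) =
  mean (fun w => counting (S w `&` A)).
Proof.
move=> tS mS mvA; rewrite -(@mean_translate v); last 2 first.
- exact: mS.
- by move=> w; exact: counting_ge0.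
congr mean; apply/funext => w.
by rewrite tS -shiftI counting_shift.
Qed.

Lemma mean_eq0 (f : conf * conf -> \bar R) : measurable_fun setT f ->
  (forall w, 0 <= f w) -> mean f = 0 -> {ae P, forall t, f (Phi t, Psi t) = 0}.
Proof.
move=> mf f0 fE.
have mg : measurable_fun setT (fun t => f (Phi t, Psi t)).
  exact: measurableT_comp mf measurable_pair.
have [ae _] := ae_eq_integral_abs P measurableT mg.
have e0 : \int[P]_t `|f (Phi t, Psi t)| = 0.
  by rewrite -[RHS]fE; apply: eq_integral => t _; rewrite gee0_abs.
by apply: filterS (ae e0) => t /(_ I).
Qed.

(** Each nonempty tile is a translate of [cell 0], so by stationarity it almost surely contains no
    point of [S]; countably many tiles cover the space. *)
Lemma ae_empty S : translation_covariant S -> measurable_counts S ->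
  mean (fun w => counting (S w `&` cell 0)) = 0 ->
  {ae P, forall t, S (Phi t, Psi t) = set0}.
Proof.
move=> tS mS S0.
have Sn n : {ae P, forall t, counting (S (Phi t, Psi t) `&` tile id n) = 0 :> \bar R}.
  apply: (@mean_eq0 (fun w => counting (S w `&` tile id n))).
  - by apply: mS; exact: coord_measurable_tile.
  - by move=> w; exact: counting_ge0.
  rewrite /tile; case: pickle_inv => [z|]; last first.
    rewrite /mean; under eq_integral do rewrite setI0 counting0.
    exact: integral0.
  rewrite -S0 -[in LHS](add0r (map_mx intr z)) -shift_cell mean_counting_shift//.
  by rewrite shift_cell; exact: coord_measurable_cell.
have /ae_foralln := Sn; apply: filterS => t tn.
apply/eqP/negPn/negP => /set0P[x Sx].
have [n _ nx] : (\bigcup_n tile id n) x by rewrite bigcup_tile.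
have /counting_eq0/seteqP[S0n _] := tn n; exact: (S0n x).
Qed.

(** If each matched point of the first configuration sends unit mass to its partner, [into B w]
    consists of the senders to [B] and [from A w] of the receivers from [A]. Here [w] is the pair of
    configurations itself. *)
Definition into B w : set E := matched_into fst snd B w.
Definition from A w : set E := matched_from fst snd A w.

(** The matching restricts to a bijection between these two sets. *)
Lemma counting_into_from A B w :
  counting (into B w `&` A) = counting (from A w `&` B) :> \bar R.
Proof.
apply: card_eq_counting.
pose g p := xget (0 : E)%R [set x | B x /\ matched (points w.1) (points w.2) p x].
have gP p : into B w p -> B (g p) /\ matched (points w.1) (points w.2) p (g p).
  move=> [x Bx m].
  exact: (xgetPex (0 : E)%R (ex_intro [set x | B x /\ matched _ _ p x] x (conj Bx m))).
apply: (card_eq_trans (B := g @` (into B w `&` A))).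
  apply/card_esym/inj_card_eq => p q /[!inE] -[/gP[_ mp] _] [/gP[_ mq] _] pq.
  by rewrite pq in mp; exact: matched_inj mp mq.
rewrite (_ : g @` _ = from A w `&` B); first exact: card_eqxx.
apply/seteqP; split=> [_ [p [/gP[Bg m] Ap] <-]|x [[p Ap m] Bx]].
  by split=> //; exists p.
have ip : into B w p by exists x.
by exists p => //; have [_ m'] := gP _ ip; exact: matched_fun m' m.
Qed.

Lemma matched_translate v w p x :
  matched (points (translate v w.1)) (points (translate v w.2)) (p + v)%R (x + v)%R <->
  matched (points w.1) (points w.2) p x.
Proof. exact: matched_shift. Qed.

Lemma into_translate v B w :
  into (shift_set v B) (translate v w.1, translate v w.2) = shift_set v (into B w).
Proof.
apply/seteqP; split=> [p [_ [x Bx <-] m]|_ [p [x Bx m] <-]].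
  exists (p - v)%R; last by rewrite subrK.
  by exists x => //; apply/(matched_translate v); rewrite subrK.
by exists (x + v)%R; [exact/shiftE|exact/(matched_translate v w p x)].
Qed.

Lemma measurable_into B : coord_measurable (W := (conf * conf)%type) B ->
  measurable_counts (into B).
Proof.
move=> mB A mA.
apply: (measurable_counting_points (measurable_fst)) => // [w p [x _ m]|i].
  exact: (matched_sub m).1.
exact: (measurable_matched_into measurable_fst measurable_snd).
Qed.

Lemma measurable_from A : coord_measurable (W := (conf * conf)%type) A ->
  measurable_counts (from A).
Proof.
move=> mA B mB.
apply: (measurable_counting_points (measurable_snd)) => // [w p [x _ m]|i].
  exact: (matched_sub m).2.
exact: (measurable_matched_from measurable_fst measurable_snd).
Qed.

Lemma mean_sum (f : nat -> conf * conf -> \bar R) (g : conf * conf -> \bar R) :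
  (forall n, measurable_fun setT (f n)) -> (forall n w, 0 <= f n w) ->
  (forall w, g w = \sum_(n <oo) f n w) ->
  mean g = \sum_(n <oo) mean (f n).
Proof.
move=> mf f0 fg; rewrite /mean; under eq_integral do rewrite fg.
apply: (integral_nneseries P measurableT (f := fun n t => f n (Phi t, Psi t))) => //.
by move=> n; exact: measurableT_comp (mf n) measurable_pair.
Qed.

(* Mass transport: sort the pairs by the tile of the partner; translating the
   pairs from [cell 0] to [cell u] by [- u] turns them into the pairs from
   [cell (- u)] to [cell 0]. *)
Lemma mean_matched_cell :
  mean (fun w => counting (into setT w `&` cell 0)) =
  mean (fun w => counting (from setT w `&` cell 0)).
Proof.
have mt s n : coord_measurable (W := (conf * conf)%type) (@tile R d s n).
  exact: coord_measurable_tile.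
have mc : coord_measurable (W := (conf * conf)%type) (@cell R d 0).
  exact: coord_measurable_cell.
rewrite (@mean_sum (fun n w => counting (into (tile id n) w `&` cell 0))); first last.
- move=> w; rewrite counting_into_from setIT.
  rewrite (counting_tiles (s := id) (F := fun n => from (cell 0) w `&` tile id n)) //.
  by apply: eq_eseriesr => n _; rewrite counting_into_from.
- by move=> n w; exact: counting_ge0.
- by move=> n; exact: measurable_into.
rewrite (@mean_sum (fun n w => counting (from (tile -%R n) w `&` cell 0))); first last.
- move=> w; rewrite -counting_into_from setIT.
  rewrite (counting_tiles (s := -%R) (F := fun n => into (cell 0) w `&` tile -%R n)).
  + by apply: eq_eseriesr => n _; rewrite counting_into_from.
  + exact: opprK.
  + by [].
- by move=> n w; exact: counting_ge0.
- by move=> n; exact: measurable_from.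
apply: eq_eseriesr => n _.
rewrite [RHS](_ : _ = mean (fun w => counting (into (cell 0) w `&` tile -%R n))); last first.
  by congr mean; apply/funext => w; rewrite counting_into_from.
rewrite /tile; case: pickle_inv => [z|]; last first.
  congr mean; apply/funext => w; rewrite setI0 counting0.
  rewrite (_ : into _ _ = set0) ?set0I ?counting0//.
  by apply/seteqP; split=> // p [].
set u : E := map_mx intr z.
have -> : map_mx intr (- z) = (- u)%R :> E by apply/rowP => k; rewrite !mxE rmorphN.
rewrite -[RHS](@mean_translate (- u)); last 2 first.
- by apply: measurable_into => //; exact: coord_measurable_cell.
- by move=> w; exact: counting_ge0.
congr mean; apply/funext => w.
have c0 : cell 0 = shift_set (- u) (cell u) by rewrite shift_cell subrr.
have cu : cell (- u) = shift_set (- u) (cell 0) by rewrite shift_cell add0r.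
by rewrite [in RHS]c0 into_translate cu -shiftI counting_shift.
Qed.

Definition unmatched1 w : set E := never_matched1 w.1 w.2.
Definition unmatched2 w : set E := never_matched2 w.1 w.2.

Lemma measurable_unmatched1 : measurable_counts unmatched1.
Proof.
move=> A mA.
apply: (measurable_counting_points measurable_fst) => // [w|i].
  exact: never_matched1_sub.
exact: (measurable_never_matched1 measurable_fst measurable_snd).
Qed.

Lemma measurable_unmatched2 : measurable_counts unmatched2.
Proof.
move=> A mA.
apply: (measurable_counting_points measurable_snd) => // [w|i].
  exact: never_matched2_sub.
exact: (measurable_never_matched2 measurable_fst measurable_snd).
Qed.

Lemma meanD (f g : conf * conf -> \bar R) :
  measurable_fun setT f -> (forall w, 0 <= f w) ->
  measurable_fun setT g -> (forall w, 0 <= g w) ->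
  mean (fun w => f w + g w) = mean f + mean g.
Proof.
move=> mf f0 mg g0; apply: (ge0_integralD P measurableT) => //.
  exact: measurableT_comp mf measurable_pair.
exact: measurableT_comp mg measurable_pair.
Qed.

(** Every point is either matched or never matched, so the mean number of points splits into a
    matched part, common to both processes by [mean_matched_cell], and a surviving part. *)
Lemma mean_cell1 : mean (fun w => npoints (cell 0) w.1) =
  mean (fun w => counting (into setT w `&` cell 0)) +
  mean (fun w => counting (unmatched1 w `&` cell 0)).
Proof.
have mc : coord_measurable (W := (conf * conf)%type) (@cell R d 0).
  exact: coord_measurable_cell.
rewrite -meanD; first last.
- by move=> w; exact: counting_ge0.
- exact: measurable_unmatched1.
- by move=> w; exact: counting_ge0.
- by apply: measurable_into => //; exact: coord_measurableT.
congr mean; apply/funext => w; rewrite -countingU.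
  rewrite -setIUl; congr (counting (_ `&` _)); apply/seteqP; split=> p.
    move=> wp; have [[x m]|nm] := pselect (exists x, matched w.1 w.2 p x).
      by left; exists x.
    by right; apply/never_matched1P; split=> // x m; apply: nm; exists x.
  by move=> [[x _ m]|/never_matched1_sub//]; exact: (matched_sub m).1.
apply/seteqP; split=> // p [[[x _ m] _] [/never_matched1P[_ nm] _]].
exact: nm m.
Qed.

Lemma mean_cell2 : mean (fun w => npoints (cell 0) w.2) =
  mean (fun w => counting (from setT w `&` cell 0)) +
  mean (fun w => counting (unmatched2 w `&` cell 0)).
Proof.
have mc : coord_measurable (W := (conf * conf)%type) (@cell R d 0).
  exact: coord_measurable_cell.
rewrite -meanD; first last.
- by move=> w; exact: counting_ge0.
- exact: measurable_unmatched2.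
- by move=> w; exact: counting_ge0.
- by apply: measurable_from => //; exact: coord_measurableT.
congr mean; apply/funext => w; rewrite -countingU.
  rewrite -setIUl; congr (counting (_ `&` _)); apply/seteqP; split=> x.
    move=> wx; have [[p m]|nm] := pselect (exists p, matched w.1 w.2 p x).
      by left; exists p.
    by right; apply/never_matched2P; split=> // p m; apply: nm; exists p.
  by move=> [[p _ m]|/never_matched2_sub//]; exact: (matched_sub m).2.
apply/seteqP; split=> // x [[[p _ m] _] [/never_matched2P[_ nm] _]].
exact: nm m.
Qed.

Lemma unmatched1_translate : translation_covariant unmatched1.
Proof. by move=> v w; exact: never_matched1_shift. Qed.

Lemma unmatched2_translate : translation_covariant unmatched2.
Proof. by move=> v w; exact: never_matched2_shift. Qed.

(** These faces make up the difference between the closed cube, which defines the intensity, and the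
    half-open [cell 0]. *)
Definition upper_face (k : 'I_d) : set E := unit_cube `&` [set x | x 0%R k = 1%R].

Lemma coord_measurableI A B :
  coord_measurable (W := (conf * conf)%type) A ->
  coord_measurable (W := (conf * conf)%type) B ->
  coord_measurable (W := (conf * conf)%type) (A `&` B).
Proof. by move=> mA mB f mf; apply: measurable_Pand; [exact: mA|exact: mB]. Qed.

Lemma coord_measurable_upper_face k :
  coord_measurable (W := (conf * conf)%type) (upper_face k).
Proof.
apply: (@coord_measurableI unit_cube); first exact: coord_measurable_unit_cube.
by move=> f mf; apply: measurable_eqr => //; exact: measurable_cst.
Qed.

Lemma coord_measurable_shift v A :
  coord_measurable (W := (conf * conf)%type) A ->
  coord_measurable (W := (conf * conf)%type) (shift_set v A).
Proof.
move=> mA f mf; rewrite (_ : mkset _ = [set w | A (f w - v)%R]).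
  apply: mA => k; under eq_fun do rewrite !mxE.
  by apply: measurable_funB => //; exact: measurable_cst.
apply/seteqP; split=> w /= => [[x Ax <-]|Ax]; first by rewrite addrK.
by exists (f w - v)%R => //; rewrite subrK.
Qed.

Lemma nneseries_cst_eq0 (c : \bar R) :
  0 <= c -> \sum_(n <oo) c < +oo -> c = 0.
Proof.
move=> c0 fin.
have cfin : c < +oo.
  apply: le_lt_trans fin.
  by have := @nneseries_lim_ge R (fun=> c) xpredT 0 1 (fun _ _ _ => c0);
    rewrite big_nat1.
case: c c0 fin cfin => [r| |]// r0 fin _.
have /cvg_series_cvg_0 c0 := @nnseries_is_cvg R (fun=> r) (fun=> r0) fin.
by congr EFin; exact: (cvg_unique _ (@cvg_cst _ r _ \oo _) c0).
Qed.

(* Infinitely many translates of a face of the cube are disjoint and contained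
   in the cube, so they carry the same finite mass only if it is zero. *)
Lemma mean_upper_face S k : translation_covariant S -> measurable_counts S ->
  mean (fun w => counting (S w `&` unit_cube)) < +oo ->
  mean (fun w => counting (S w `&` upper_face k)) = 0.
Proof.
move=> tS mS fin.
(* The vector [e n] has entry [- 1/(n+1)] in direction [k] and zeros elsewhere: it lowers the face
   from height 1 to [1 - 1/(n+1)]. These heights are distinct and stay within the cube. *)
have [e eE] : exists e : nat -> E,
    forall n l, (e n 0 l = - (n.+1%:R^-1 * (l == k)%:R))%R.
  by exists (fun n => - (n.+1%:R^-1 *: delta_mx 0 k))%R => n l; rewrite !mxE eqxx.
have shiftH n : shift_set (e n) (upper_face k) `<=` unit_cube.
  move=> _ [x [x01 xk] <-] l; rewrite mxE eE.
  have [->|lk] := eqVneq l k; last by rewrite mulr0 oppr0 addr0.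
  rewrite mulr1 xk subr_ge0 lerBlDr lerDl invr_ge0 ler0n andbT.
  by rewrite invf_le1 ?ltr0n// ler1n.
have trivH : trivIset setT (fun n => shift_set (e n) (upper_face k)).
  move=> m n _ _ [_ [[x [_ xk] <-] [y [_ yk] /(congr1 (fun z : E => z 0%R k))]]].
  rewrite !mxE !eE eqxx !mulr1 xk yk => /addrI/oppr_inj/invr_inj/eqP.
  by rewrite eqr_nat => /eqP[].
have mface := coord_measurable_upper_face k.
set c := mean _.
have cE n : mean (fun w => counting (S w `&` shift_set (e n) (upper_face k))) = c.
  by apply: mean_counting_shift => //; exact: coord_measurable_shift.
have mSn n : measurable_fun setT (fun w =>
    counting (S w `&` shift_set (e n) (upper_face k)) : \bar R).
  by apply: mS; exact: coord_measurable_shift.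
apply: nneseries_cst_eq0; first by apply: mean_ge0 => w; exact: counting_ge0.
apply: le_lt_trans fin.
have -> : \sum_(n <oo) c = \sum_(n <oo)
    mean (fun w => counting (S w `&` shift_set (e n) (upper_face k))).
  by apply: eq_eseriesr => n _; rewrite cE.
rewrite -(@mean_sum _ (fun w =>
    \sum_(n <oo) counting (S w `&` shift_set (e n) (upper_face k))))//; last first.
  by move=> n w; exact: counting_ge0.
apply: ge0_le_integral => //.
- by move=> t _; apply: nneseries_ge0 => n _ _; exact: counting_ge0.
- apply: ge0_emeasurable_sum => [n t _ _|n _]; first exact: counting_ge0.
  exact: measurableT_comp (mSn n) measurable_pair.
- apply: measurable_counts_pair => //; exact: coord_measurable_unit_cube.
- move=> t _; rewrite -counting_bigcup; last first.
    move=> m n _ _ [x [[_ xm] [_ xn]]]; apply: trivH => //.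
    by exists x.
  rewrite -setI_bigcupr; apply: le_counting; apply: setIS => x [n _].
  exact: shiftH.
Qed.

(** Almost surely no upper face carries a point of [S], so the counts in the cube and in the cell
    agree. Finiteness of the mean is what [mean_upper_face] requires. *)
Lemma mean_unit_cube S : translation_covariant S -> measurable_counts S ->
  mean (fun w => counting (S w `&` unit_cube)) < +oo ->
  mean (fun w => counting (S w `&` unit_cube)) =
  mean (fun w => counting (S w `&` cell 0)).
Proof.
move=> tS mS fin; apply: ge0_ae_eq_integral => //.
- apply: measurable_counts_pair => //; exact: coord_measurable_unit_cube.
- apply: measurable_counts_pair => //; exact: coord_measurable_cell.
- by move=> t _; exact: counting_ge0.
- by move=> t _; exact: counting_ge0.
have ae_face k : {ae P, forall t,
    counting (S (Phi t, Psi t) `&` upper_face k) = 0 :> \bar R}.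
  apply: (@mean_eq0 (fun w => counting (S w `&` upper_face k))).
  - by apply: mS; exact: coord_measurable_upper_face.
  - by move=> w; exact: counting_ge0.
  - exact: mean_upper_face.
have /filter_forall := ae_face; apply: filterS => t tk _.
congr counting; apply/seteqP; split=> x [Sx xC]; split=> //.
  move=> k; rewrite mxE add0r; have /andP[x0 x1] := xC k; split=> //.
  rewrite lt_neqAle x1 andbT; apply/eqP => xk.
  by have /counting_eq0/seteqP[S0 _] := tk k; exact: (S0 x).
by move=> k; have [] := xC k; rewrite mxE add0r => -> /ltW ->.
Qed.

Lemma intensity1 : intensity Phi < +oo ->
  intensity Phi = mean (fun w => npoints (cell 0) w.1).
Proof.
apply: (@mean_unit_cube (fun w => points w.1)) => // A mA.
exact: measurable_npoints_coord measurable_fst mA.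
Qed.

Lemma intensity2 : intensity Psi < +oo ->
  intensity Psi = mean (fun w => npoints (cell 0) w.2).
Proof.
apply: (@mean_unit_cube (fun w => points w.2)) => // A mA.
exact: measurable_npoints_coord measurable_snd mA.
Qed.

Lemma mean_ae0 (S : conf * conf -> set E) : measurable_counts S ->
  {ae P, forall t, S (Phi t, Psi t) = set0} ->
  mean (fun w => counting (S w `&` cell 0)) = 0.
Proof.
move=> mS S0; rewrite -[RHS](integral0 P setT).
apply: ge0_ae_eq_integral => //.
- apply: measurable_counts_pair => //; exact: coord_measurable_cell.
- by move=> t _; exact: counting_ge0.
by apply: filterS S0 => t -> _; rewrite set0I counting0.
Qed.

End transport.

(** * The zero-one law and the conclusion *)

Section matching_probability.
Context {R : realType} {d : nat} {dT : measure_display} {T : measurableType dT}.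
Local Notation conf := (configuration R d).
Variables (P : probability T R) (Phi Psi : {RV P >-> conf}).

(** Covariance of [S] makes its nonemptiness a translation invariant event, so a probability other
    than 0 is 1. *)
Lemma ergodic_ae_nonempty (S : conf * conf -> set 'rV[R]_d) :
  jointly_ergodic Phi Psi -> translation_covariant S ->
  measurable [set w | S w !=set0] ->
  P [set t | S (Phi t, Psi t) !=set0] <> 0%E ->
  {ae P, forall t, S (Phi t, Psi t) !=set0}.
Proof.
move=> [_ erg] tS mS; have := erg _ mS; case => [v phi psi||P1 _]//.
  rewrite /= -[translate v phi]/(translate v (phi, psi).1).
  rewrite -[translate v psi]/(translate v (phi, psi).2) tS.
  split=> [[_ [x Sx _]]|[x Sx]]; first by exists x.
  by exists (x + v); exact/shiftE.
have mSt : measurable [set t | S (Phi t, Psi t) !=set0].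
  by have := @measurable_pair _ _ _ _ P Phi Psi measurableT _ mS; rewrite setTI.
have Pc : P (~` [set t | S (Phi t, Psi t) !=set0]) = 0%E.
  by rewrite probability_setC// P1 subee.
by apply/negligibleP => //; exact: measurableC.
Qed.

Lemma ae_notF : ~ {ae P, forall t, False}.
Proof.
move=> [N [mN N0 FN]].
have NT : N = setT by apply/seteqP; split=> // t _; apply: FN => -[].
by have := probability_setT P; rewrite -NT N0 => /esym/eqP; rewrite onee_eq0.
Qed.

End matching_probability.

Unset Implicit Arguments.
Set Strict Implicit.
Set Printing Implicit Defensive.

Theorem theorem3p1 (R : realType) (d : nat) (dT : measure_display)
    (T : measurableType dT) (P : probability T R)
    (Phi Psi : {RV P >-> configuration R d}) (alpha : R)
    (halpha : 1 <= alpha)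
    (hergodic : jointly_ergodic Phi Psi)
    (hPhi : intensity Phi = 1%E)
    (hPsi : intensity Psi = alpha%:E)
    (hchain : {ae P, forall w,
       ~ exists z : nat -> 'rV[R]_d,
           infinite_descending_chain (Phi w) (Psi w) z}) :
  P [set w | tau_points1 (Phi w) (Psi w) = Phi w] = 1%E /\
  (alpha = 1 -> P [set w | tau_points2 (Phi w) (Psi w) = Psi w] = 1%E).
Proof.
have [stationary _] := hergodic.
have mean1 := mean_cell1 Phi Psi; have mean2 := mean_cell2 Phi Psi.
(* Both intensities are finite, hence equal to the means on [cell 0]. This gives [1 = s + u1] and,
   since the matched parts agree, [alpha = s + u2]. *)
rewrite -intensity1 ?hPhi ?ltry// in mean1.
rewrite -intensity2 ?hPsi ?ltry// -mean_matched_cell// in mean2.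
set s := mean _ _ _ in mean1 mean2.
set u1 := mean _ _ _ in mean1; set u2 := mean _ _ _ in mean2.
have u10 : (0 <= u1)%E by apply: mean_ge0 => w; exact: counting_ge0.
have u20 : (0 <= u2)%E by apply: mean_ge0 => w; exact: counting_ge0.
have one_empty : {ae P, forall t, never_matched1 (Phi t) (Psi t) = set0 \/
    never_matched2 (Phi t) (Psi t) = set0}.
  apply: filterS hchain => t; apply: no_chain_never_matched.
    exact: points_locally_finite.
  exact: points_locally_finite.
(* The events of the conclusion are complements of the events that survivors exist, whose
   measurability is known. *)
have tauP (S : configuration R d * configuration R d -> set 'rV[R]_d)
    (B : set T) : measurable [set t | S (Phi t, Psi t) !=set0] ->
    (forall t, B t <-> S (Phi t, Psi t) = set0) ->
    P [set t | S (Phi t, Psi t) !=set0] = 0%E -> P B = 1%E.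
  move=> mS BE S0; rewrite (_ : B = ~` [set t | S (Phi t, Psi t) !=set0]).
    by rewrite probability_setC// S0 sube0.
  apply/seteqP; split=> t /=; first by move=> /BE ->; case.
  by move=> nS; apply/BE/eqP/negPn/negP => /set0P.
split=> [|alpha1].
  apply: (tauP unmatched1); first exact: measurable_never_matched1_ex.
    by move=> t; exact: tau_points1E.
  apply: contrapT => /(ergodic_ae_nonempty hergodic (@unmatched1_translate _ _)).
  move=> /(_ (measurable_never_matched1_ex measurable_fst measurable_snd)) ne1.
  have e2 : {ae P, forall t, unmatched2 (Phi t, Psi t) = set0}.
    apply: filterS2 one_empty ne1 => t; rewrite /unmatched1/= => -[->|//].
    by case.
  have u2E : u2 = 0%E by apply: mean_ae0 => //; exact: measurable_unmatched2.
  have u1E : u1 = 0%E.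
    (* With [u2 = 0] the second balance reads [alpha = s], and the first becomes [1 = alpha + u1].
       This excludes an infinite [u1], and [alpha >= 1] with [u1 >= 0] leaves only zero. *)
    have : 1%E = (alpha%:E + u1)%E by rewrite mean2 u2E adde0.
    case: (u1) u10 => [r| |]//; rewrite lee_fin => r0 -[] e; congr EFin.
    by move: e halpha; lra.
  have e1 : {ae P, forall t, unmatched1 (Phi t, Psi t) = set0}.
    exact: (ae_empty stationary (@unmatched1_translate _ _)
      (@measurable_unmatched1 _ _) u1E).
  by apply: (@ae_notF _ _ _ P); apply: filterS2 ne1 e1 => t + E0; rewrite E0; case.
apply: (tauP unmatched2); first exact: measurable_never_matched2_ex.
  by move=> t; exact: tau_points2E.
apply: contrapT => /(ergodic_ae_nonempty hergodic (@unmatched2_translate _ _)).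
move=> /(_ (measurable_never_matched2_ex measurable_fst measurable_snd)) ne2.
have e1 : {ae P, forall t, unmatched1 (Phi t, Psi t) = set0}.
  apply: filterS2 one_empty ne2 => t; rewrite /unmatched2/= => -[//|->].
  by case.
have u1E : u1 = 0%E by apply: mean_ae0 => //; exact: measurable_unmatched1.
have u2E : u2 = 0%E.
  (* Here [u1 = 0] makes the matched part [s] equal to the full intensity 1, so [alpha = 1] leaves
     nothing for [u2]. *)
  have sE : s = 1%E by rewrite mean1 u1E adde0.
  move: mean2; rewrite sE alpha1.
  case: (u2) u20 => [r| |]//; rewrite lee_fin => r0 -[] e; congr EFin.
  by move: e; lra.
have e2 : {ae P, forall t, unmatched2 (Phi t, Psi t) = set0}.
  exact: (ae_empty stationary (@unmatched2_translate _ _)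
    (@measurable_unmatched2 _ _) u2E).
by apply: (@ae_notF _ _ _ P); apply: filterS2 ne2 e2 => t + E0; rewrite E0; case.
Qed.
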